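(* (i) Let $n\ge 0$ be an integer and $(\mathfrak a,\omega_{\mathfrak a})$ a symplectic Lie algebra. The set of isomorphism classes of symplectic Lie algebras $(\mathfrak g,\omega)$ whose ideal $\mathfrak j=\mathfrak z\cap\mathfrak z^\perp$ is $n$-dimensional and whose associated symplectic Lie algebra $(\mathfrak j^\perp/\mathfrak j,\overline\omega)$ is isomorphic to $(\mathfrak a,\omega_{\mathfrak a})$ is in one-to-one correspondence with the orbit space $H^2(\mathbb R^n,\mathfrak a,\omega_{\mathfrak a})_\sharp/G$, the class of $[\gamma,\epsilon,\xi]$ corresponding to the isomorphism class of $\mathfrak d_{\gamma,\epsilon,\xi}(\mathbb R^n,\mathfrak a)$. (ii) Let $\operatorname{Isom}(2k)$ denote a system of representatives of the isomorphism classes of symplectic Lie algebras of dimension $2k$. For every $n\geq 1$ there is (via the same correspondence) a bijection between the set of isomorphism classes of symplectic Lie algebras of dimension $2n$ with degenerate center and the set $$\coprod_{m=1}^n\ \coprod_{[\mathfrak a,\omega_{\mathfrak a}]\in\operatorname{Isom}(2n-2m)}H^2(\mathbb R^m,\mathfrak a,\omega_{\mathfrak a})_\sharp/G.$$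
   Context: All vector spaces and Lie algebras are real and finite-dimensional. A symplectic Lie algebra $(\mathfrak g,\omega)$ is a Lie algebra $\mathfrak g$ with a skew-symmetric non-degenerate bilinear form $\omega$ such that $\omega([X,Y],Z)+\omega([Y,Z],X)+\omega([Z,X],Y)=0$ for all $X,Y,Z$. An isomorphism of symplectic Lie algebras is a Lie algebra isomorphism $\varphi$ with $\varphi^*\omega_2=\omega_1$. $\mathfrak z$ is the center of $\mathfrak g$, ${}^\perp$ is with respect to $\omega$, the center is degenerate if $\mathfrak z\cap\mathfrak z^\perp\ne0$. For $\mathfrak j=\mathfrak z\cap\mathfrak z^\perp$, $\mathfrak j^\perp$ is an ideal and $\overline\omega$ is the symplectic form on $\mathfrak j^\perp/\mathfrak j$ induced by $\omega$. Let $\mathfrak l$ be an abelian Lie algebra (e.g. $\mathbb R^n$) and $(\mathfrak a,\omega_{\mathfrak a})$ symplectic. Let $\gamma:\mathfrak l\to\operatorname{Hom}(\mathfrak a,\mathfrak l^* )$ and $\xi:\mathfrak l\to\operatorname{Hom}(\mathfrak a,\mathfrak a)$ be linear and $\epsilon:\mathfrak l\times\mathfrak l\to\mathfrak l^*$ alternating bilinear. Write $\gamma(L_1,A,L_2):=(\gamma(L_1)(A))(L_2)$. Define alternating bilinear maps $\alpha:\mathfrak l\times\mathfrak l\to\mathfrak a$, $\beta:\mathfrak a\times\mathfrak a\to\mathfrak l^*$ by $$\omega_{\mathfrak a}(\alpha(L_1,L_2),A)=\gamma(L_1,A,L_2)-\gamma(L_2,A,L_1),\qquad \beta(A_1,A_2)(L)=-\omega_{\mathfrak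 a}(\xi(L)A_1,A_2)-\omega_{\mathfrak a}(A_1,\xi(L)A_2).$$ $Z^2(\mathfrak l,\mathfrak a,\omega_{\mathfrak a})$ is the set of such triples with, for all $L,L_i\in\mathfrak l$, $A,A_i\in\mathfrak a$: (1) every $\xi(L)$ is a derivation of $\mathfrak a$, $\xi(L_1)\xi(L_2)-\xi(L_2)\xi(L_1)=\operatorname{ad}_{\mathfrak a}(\alpha(L_1,L_2))$, and $\xi(L_1)\alpha(L_2,L_3)+\xi(L_2)\alpha(L_3,L_1)+\xi(L_3)\alpha(L_1,L_2)=0$; (2) $\beta(\xi(L)A_1,A_2)+\beta(A_1,\xi(L)A_2)=\gamma(L)[A_1,A_2]_{\mathfrak a}$; (3) $\gamma(L_2)(\xi(L_1)A)-\gamma(L_1)(\xi(L_2)A)+\beta(\alpha(L_1,L_2),A)=0$; (4) $\gamma(L_1)\alpha(L_2,L_3)+\gamma(L_2)\alpha(L_3,L_1)+\gamma(L_3)\alpha(L_1,L_2)=0$; (5) $\epsilon(L_1,L_2)L_3+\epsilon(L_2,L_3)L_1+\epsilon(L_3,L_1)L_2=0$. For $(\gamma,\epsilon,\xi)\in Z^2(\mathfrak l,\mathfrak a,\omega_{\mathfrak a})$, $\mathfrak d_{\gamma,\epsilon,\xi}(\mathfrak l,\mathfrak a)$ is the symplectic Lie algebra $\mathfrak l^*\oplus\mathfrak a\oplus\mathfrak l$ with brackets $[\mathfrak l^*,\cdot]=0$, $[A_1,A_2]=\beta(A_1,A_2)+[A_1,A_2]_{\mathfrak a}$, $[L,A]=\gamma(L)A+\xi(L)A$,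 $[L_1,L_2]=\epsilon(L_1,L_2)+\alpha(L_1,L_2)$ and form $\omega(Z_1+A_1+L_1,Z_2+A_2+L_2)=Z_1(L_2)+\omega_{\mathfrak a}(A_1,A_2)-Z_2(L_1)$. $Z^2(\mathfrak l,\mathfrak a,\omega_{\mathfrak a})_\sharp$ is the set of $(\gamma,\epsilon,\xi)\in Z^2(\mathfrak l,\mathfrak a,\omega_{\mathfrak a})$ such that (a) $L=0$ is the only $L\in\mathfrak l$ for which there is an $A\in\mathfrak a$ satisfying simultaneously $\operatorname{ad}_{\mathfrak a}(A)+\xi(L)=0$, $\gamma(L)+\beta(A,\cdot)=0$, $\alpha(L,L')=\xi(L')A$ and $\epsilon(L,L')=\gamma(L')A$ for all $L'\in\mathfrak l$; (b) the subspace $\{A\in\mathfrak z(\mathfrak a): \beta(A,\cdot)=0,\ \xi(L)A=0,\ \gamma(L)A=0\ \forall L\in\mathfrak l\}$ of $\mathfrak a$ is non-degenerate with respect to $\omega_{\mathfrak a}$ (the zero subspace counts as non-degenerate). The additive group $C^1(\mathfrak l,\mathfrak a)=\operatorname{Hom}(\mathfrak l,\mathfrak a)$ acts on triples by $(\gamma,\epsilon,\xi)\tau=(\gamma',\epsilon',\xi')$, where, with $\tau^*:\mathfrak a\to\mathfrak l^*$, $\tau^*(A)(L)=\omega_{\mathfrak a}(\tau L,A)$, $\xi'(L)A=\xi(L)A-[\tau L,A]_{\mathfrak a}$, $\gamma'(L)A=\gamma(L)A+\tau^*(\xi(L)A)-\tau^*([\tau L,A]_{\mathfrak a})-\beta(\tau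 L,A)$, $\epsilon'(L_1,L_2)=\epsilon(L_1,L_2)+\tau^*(\alpha(L_1,L_2))-\gamma(L_1)(\tau L_2)+\gamma(L_2)(\tau L_1)-\tau^*(\xi(L_1)\tau L_2-\xi(L_2)\tau L_1)+\tau^*([\tau L_1,\tau L_2]_{\mathfrak a})+\beta(\tau L_1,\tau L_2)$. This action preserves $Z^2(\mathfrak l,\mathfrak a,\omega_{\mathfrak a})_\sharp$; the orbit space is $H^2(\mathfrak l,\mathfrak a,\omega_{\mathfrak a})_\sharp$, and $[\gamma,\epsilon,\xi]$ is the class of $(\gamma,\epsilon,\xi)$. $G=G(\mathfrak l,\mathfrak a,\omega_{\mathfrak a})$ is the set of pairs $(S,U)$ with $S$ an automorphism of the vector space $\mathfrak l$ and $U$ an automorphism of the symplectic Lie algebra $(\mathfrak a,\omega_{\mathfrak a})$. It acts on $H^2(\mathfrak l,\mathfrak a,\omega_{\mathfrak a})_\sharp$ by $(S,U)^*[\gamma,\epsilon,\xi]=[\gamma'',\epsilon'',\xi'']$ with $\gamma''(L)A=S^*(\gamma(SL)(U^{-1}A))$, $\epsilon''(L_1,L_2)=S^*(\epsilon(SL_1,SL_2))$, $\xi''(L)A=U\xi(SL)U^{-1}A$, where $S^*:\mathfrak l^*\to\mathfrak l^*$ is the transpose of $S$. $H^2(\cdot)_\sharp/G$ is the set of orbits. *)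

(* Defs.v *)
From HB Require Import structures.
From mathcomp Require Import all_boot all_order all_algebra.
From mathcomp Require Import boolp classical_sets functions reals.
From mathcomp Require Import lra.

Set Implicit Arguments.
Unset Strict Implicit.
Unset Printing Implicit Defensive.

Import GRing.Theory Num.Theory.
Local Open Scope ring_scope.
Local Open Scope quotient_scope.
Local Open Scope classical_set_scope.

(* [linfun] is only meaningful on linear functions; every use below comes with
   an evaluation lemma ([alphaE], [betaE], [xi_actE], [ext_brE], ...) showing
   that the bound function is (bi)linear. *)
Definition bilfun (K : fieldType) (U V W : vectType K) (f : U -> V -> W) :
    'Hom(U, 'Hom(V, W)) :=
  linfun (fun u => linfun (f u)).

Lemma linfunE (K : fieldType) (U V : vectType K) (f : U -> V) : linear f -> linfun f =1 f.
Proof.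
move=> fl u; pose m := GRing.isLinear.Build K U V *:%R f fl.
pose F : {linear U -> V} := HB.pack f m.
exact: (lfunE F).
Qed.

Section LinClosure.
Variables (K : fieldType) (U V W X : vectType K).

Lemma lin_id : linear (fun x : U => x). Proof. by []. Qed.

Lemma lin_add (f g : U -> V) :
  linear f -> linear g -> linear (fun x => f x + g x).
Proof. by move=> fl gl k x y; rewrite fl gl scalerDr addrACA. Qed.

Lemma lin_opp (f : U -> V) : linear f -> linear (fun x => - f x).
Proof. by move=> fl k x y; rewrite fl opprD scalerN. Qed.

Lemma lin_app (h : 'Hom(V, W)) (f : U -> V) :
  linear f -> linear (fun x => h (f x)).
Proof. by move=> fl k x y; rewrite fl linearP. Qed.

Lemma lin_eval (f : U -> 'Hom(V, W)) v : linear f -> linear (fun x => f x v).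
Proof. by move=> fl k x y; rewrite fl add_lfunE scale_lfunE. Qed.

Lemma lin_0 : linear (fun _ : U => 0 : V).
Proof. by move=> k x y; rewrite scaler0 addr0. Qed.

Lemma lin_pair (f : U -> V) (g : U -> W) :
  linear f -> linear g -> linear (fun x => (f x, g x)).
Proof. by move=> fl gl k x y; rewrite fl gl. Qed.

Lemma lin_fst (f : U -> (V * W)%type) :
  linear f -> linear (fun x => (f x).1).
Proof. by move=> fl k x y; rewrite fl. Qed.

Lemma lin_snd (f : U -> (V * W)%type) :
  linear f -> linear (fun x => (f x).2).
Proof. by move=> fl k x y; rewrite fl. Qed.

Lemma lin_comp (f : U -> 'Hom(V, W)) (h : 'Hom(X, V)) :
  linear f -> linear (fun x => (f x \o h)%VF).
Proof.
move=> fl k x y; rewrite fl; apply/lfunP => z.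
by rewrite comp_lfunE !add_lfunE !scale_lfunE !comp_lfunE.
Qed.

Lemma lin_linfun (f : U -> V -> W) :
  (forall v, linear (f^~ v)) -> (forall u, linear (f u)) ->
  linear (fun u => linfun (f u)).
Proof.
move=> fl fr k x y; apply/lfunP => z.
rewrite add_lfunE scale_lfunE !linfunE //; exact: fl.
Qed.

End LinClosure.

Ltac lin := repeat (cbv beta; match goal with
  | |- GRing.linear_for _ (fun x => x) => exact: lin_id
  | |- GRing.linear_for _ (fun x => Algebra.zero) => exact: lin_0
  | |- GRing.linear_for _ (fun x => Algebra.add (@?f x) (@?g x)) =>
      refine (@lin_add _ _ _ f g _ _)
  | |- GRing.linear_for _ (fun x => Algebra.opp (@?f x)) =>
      refine (@lin_opp _ _ _ f _)
  | |- GRing.linear_for _ (fun x => linfun (@?f x)) =>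
      refine (@lin_linfun _ _ _ _ f _ _)
  | |- GRing.linear_for _ (fun x => comp_lfun (@?f x) ?h) =>
      refine (@lin_comp _ _ _ _ _ f h _)
  | |- GRing.linear_for _ (fun x => fun_of_lfun ?h (@?f x)) =>
      refine (@lin_app _ _ _ _ h f _)
  | |- GRing.linear_for _ (fun x => fun_of_lfun (@?f x) ?w) =>
      refine (@lin_eval _ _ _ _ f w _)
  | |- GRing.linear_for _ (fun x => (@?f x, @?g x)) =>
      refine (@lin_pair _ _ _ _ f g _ _)
  | |- GRing.linear_for _ (fun x => (@?f x).1) => refine (@lin_fst _ _ _ _ f _)
  | |- GRing.linear_for _ (fun x => (@?f x).2) => refine (@lin_snd _ _ _ _ f _)
  | |- GRing.linear_for _ (fun_of_lfun ?h) => exact: linearP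
  | |- forall v, _ => intro
  end).

Lemma bilfunE (K : fieldType) (U V W : vectType K) (f : U -> V -> W) :
  (forall v, linear (f^~ v)) -> (forall u, linear (f u)) ->
  forall u v, bilfun f u v = f u v.
Proof. by move=> fl fr u v; rewrite linfunE ?linfunE //; exact: lin_linfun. Qed.

(* The quotient space [V / U]. *)
Section QuotientSpace.
Variables (K : fieldType) (V : vectType K) (U : {vspace V}).

Definition quotv : Type := Quotient.quot (pred_of_vspace U).

HB.instance Definition _ := GRing.Zmodule.on quotv.

Definition qpi (x : V) : quotv := \pi_(Quotient.quot (pred_of_vspace U)) x.
Definition qrepr (q : quotv) : V :=
  @repr V (Quotient.quot (pred_of_vspace U)) q.

Lemma qreprK : cancel qrepr qpi. Proof. exact: reprK. Qed.

Lemma qpiP x y : (qpi x = qpi y) <-> (x - y \in U).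
Proof. by rewrite (Quotient.idealrBE (pred_of_vspace U)); split => /eqP. Qed.

Lemma qpiD x y : qpi (x + y) = qpi x + qpi y.
Proof. exact: (raddfD \pi_(Quotient.quot (pred_of_vspace U))). Qed.

Definition qscale (k : K) (q : quotv) : quotv := qpi (k *: qrepr q).

Lemma qscaleE k x : qscale k (qpi x) = qpi (k *: x).
Proof.
by apply/qpiP; rewrite -scalerBr rpredZ //; apply/qpiP; rewrite qreprK.
Qed.

Fact qscaleA a b q : qscale a (qscale b q) = qscale (a * b) q.
Proof. by rewrite -[q]qreprK !qscaleE scalerA. Qed.
Fact qscale1 : left_id 1 qscale.
Proof. by move=> q; rewrite -[q]qreprK qscaleE scale1r. Qed.
Fact qscaleDr : right_distributive qscale +%R.
Proof.
by move=> k p q; rewrite -[p]qreprK -[q]qreprK -qpiD !qscaleE scalerDr qpiD.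
Qed.
Fact qscaleDl q : {morph qscale^~ q : a b / a + b}.
Proof. by move=> a b; rewrite -[q]qreprK !qscaleE scalerDl qpiD. Qed.

HB.instance Definition _ := GRing.Zmodule_isLmodule.Build K quotv
  qscaleA qscale1 qscaleDr qscaleDl.

Lemma qpiZ k x : qpi (k *: x) = k *: qpi x.
Proof. by rewrite -qscaleE. Qed.

Lemma qpi_is_linear : linear qpi.
Proof. by move=> k x y; rewrite qpiD qpiZ. Qed.

Fact quotv_vect_iso : Vector.axiom (\dim U^C) quotv.
Proof.
have cap0 : (U^C :&: U = 0)%VS by rewrite capvC capv_compl.
have kerp x : x \in U -> daddv_pi U^C U x = 0.
  move=> xU.
  have := daddv_pi_add cap0 (w := x); rewrite addvC addv_complf memvf => /(_ isT).
  by rewrite (daddv_pi_id (capv_compl U) xU) -[RHS]add0r => /addIr.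
pose f q := vsproj U^C (daddv_pi U^C U (qrepr q)).
have fE x : f (qpi x) = vsproj U^C (daddv_pi U^C U x).
  rewrite /f; congr vsproj; apply/eqP; rewrite -subr_eq0 -linearB /= kerp //.
  by apply/qpiP; rewrite qreprK.
have [v vl vb] := subvs_vect_iso U^C.
exists (v \o f).
  move=> k p q; rewrite -[p]qreprK -[q]qreprK -qpiZ -qpiD /= !fE !linearP.
  exact: vl.
apply: bij_comp => //.
exists (fun w => qpi (vsval w)) => [q|w].
  rewrite -[q]qreprK fE vsprojK ?memv_pi //; apply/qpiP.
  have := daddv_pi_add cap0 (w := qrepr q).
  rewrite addvC addv_complf memvf => /(_ isT) e.
  by rewrite -[X in _ - X]e opprD addrA subrr add0r rpredN memv_pi.
by rewrite fE daddv_pi_id ?subvsP // vsvalK.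
Qed.

HB.instance Definition _ := Lmodule_hasFinDim.Build K quotv quotv_vect_iso.

HB.instance Definition _ :=
  GRing.isLinear.Build K V quotv _ qpi qpi_is_linear.

End QuotientSpace.

(* The bracket is curried as [X |-> ad X] and the form as [X |-> om(X, -)], so
   bilinearity is carried by the types. *)
Record symplLie (R : realType) := SymplLie {
  carrier :> vectType R;
  br : 'Hom(carrier, 'End(carrier));
  om : 'Hom(carrier, 'Hom(carrier, R^o));
  brxx : forall X, br X X = 0;
  jacobi : forall X Y Z,
    br X (br Y Z) + br Y (br Z X) + br Z (br X Y) = 0;
  om_skew : forall X Y, om X Y = - om Y X;
  om_nondeg : forall X, (forall Y, om X Y = 0) -> X = 0;
  om_closed : forall X Y Z,
    om (br X Y) Z + om (br Y Z) X + om (br Z X) Y = 0 }.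

Arguments br {R s}.
Arguments om {R s}.

Section Basics.
Variable R : realType.
Implicit Types g h : symplLie R.

Definition sympl_iso g h (phi : 'Hom(g, h)) : Prop :=
  [/\ bijective phi,
      forall X Y, phi (br X Y) = br (phi X) (phi Y)
    & forall X Y, om (phi X) (phi Y) = om X Y].

Definition isomorphic g h : Prop := exists phi : 'Hom(g, h), sympl_iso phi.

Definition center g : {vspace g} := lker (br (s := g)).

Definition perp g (W : {vspace g}) : {vspace g} :=
  lker (linfun (fun X => (om X \o linfun (@vsval _ _ W))%VF)).

Definition jj g : {vspace g} := (center g :&: perp (center g))%VS.

Definition degenerate_center g : Prop := jj g <> 0%VS.

Lemma brC g (X Y : g) : br X Y = - br Y X.
Proof.
have := brxx (X + Y); rewrite !linearD /= !add_lfunE !brxx addr0 add0r => /eqP.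
by rewrite addrC addr_eq0 => /eqP.
Qed.

Lemma centerP g (X : g) : reflect (forall Y, br X Y = 0) (X \in center g).
Proof.
rewrite memv_ker; apply: (iffP eqP) => [-> Y|H]; first by rewrite zero_lfunE.
by apply/lfunP => Y; rewrite H zero_lfunE.
Qed.

Lemma perpP g (W : {vspace g}) (X : g) :
  reflect (forall Y, Y \in W -> om X Y = 0) (X \in perp W).
Proof.
have vE (Y : subvs_of W) : linfun (@vsval _ _ W) Y = vsval Y by rewrite lfunE.
have E : linfun (fun X : g => (om X \o linfun (@vsval _ _ W))%VF) X =
         (om X \o linfun (@vsval _ _ W))%VF.
  rewrite linfunE // => k x y; apply/lfunP => z.
  by rewrite !lfunE /= !lfunE /= !lfunE linearP /= !lfunE /= !lfunE.
rewrite memv_ker E; apply: (iffP eqP) => [H Y YW|H].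
  have /lfunP/(_ (Subvs YW)) := H.
  by rewrite comp_lfunE vE zero_lfunE.
by apply/lfunP => Y; rewrite comp_lfunE vE H ?subvsP // zero_lfunE.
Qed.

Lemma om_lker0 g : lker (om (s := g)) == 0%VS.
Proof.
apply/eqP/vspaceP => X; rewrite memv_ker memv0; apply/eqP/eqP => [H|->].
  by apply: om_nondeg => Y; rewrite H zero_lfunE.
by rewrite linear0.
Qed.

Lemma om_limg g : limg (om (s := g)) = fullv.
Proof.
apply/eqP; rewrite eqEdim subvf /= limg_dim_eq ?(eqP (om_lker0 g)) ?capv0 //.
by rewrite !dimvf /dim /= muln1.
Qed.

(* The inverse of the isomorphism [X |-> om X] from [g] to its dual. *)
Definition sharp g : 'Hom('Hom(g, R^o), g) := (om (s := g))^-1%VF.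

Lemma sharpK g (f : 'Hom(g, R^o)) : om (sharp g f) = f.
Proof. by apply: limg_lfunVK; rewrite om_limg memvf. Qed.

Lemma perpK g (W : {vspace g}) : perp (perp W) = W.
Proof.
apply/vspaceP => X; apply/idP/idP => [/perpP H|XW]; last first.
  by apply/perpP => Y /perpP /(_ _ XW) e; rewrite om_skew e oppr0.
suff -> : X = projv W X by exact: memv_proj.
apply/eqP; rewrite -subr_eq0; apply/eqP/om_nondeg => Z.
pose f := (om Z \o (\1 - projv W))%VF.
have fE Y : f Y = om Z (Y - projv W Y).
  by rewrite comp_lfunE add_lfunE opp_lfunE id_lfunE.
have /H : sharp g f \in perp W.
  by apply/perpP => Y YW; rewrite sharpK fE projv_id // subrr linear0.
by move=> e; rewrite om_skew -fE -(sharpK f) om_skew e !oppr0.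
Qed.

Lemma br_in_perp g (X Y : g) : X \in perp (jj g) -> br X Y \in perp (jj g).
Proof.
move=> /perpP HX; apply/perpP => Z Zj; have := Zj; rewrite memv_cap.
case/andP => /centerP Zc _; have := om_closed X Y Z.
by rewrite (brC Y Z) !Zc oppr0 !linear0 !zero_lfunE !addr0.
Qed.

End Basics.

Section Reduction.
Variables (R : realType) (g : symplLie R).

Local Notation W := (subvs_of (perp (jj g))).

Definition jj_in_perp : {vspace W} :=
  (linfun (@vsval _ _ (perp (jj g))) @^-1: jj g)%VS.

Local Notation Q := (quotv jj_in_perp).

Definition red_br : 'Hom(Q, 'End(Q)) :=
  bilfun (fun p q =>
    qpi jj_in_perp (vsproj _ (br (vsval (qrepr p)) (vsval (qrepr q))))).

Definition red_om : 'Hom(Q, 'Hom(Q, R^o)) :=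
  bilfun (fun p q : Q => om (vsval (qrepr p)) (vsval (qrepr q)) : R^o).

Lemma mem_jj_in_perp (x : W) : (x \in jj_in_perp) = (vsval x \in jj g).
Proof. by rewrite -memv_preim lfunE. Qed.

Let q_ind (P : Q -> Prop) : (forall x : W, P (qpi _ x)) -> forall p, P p.
Proof. by move=> H p; rewrite -[p]qreprK. Qed.

Let reprE (x : W) :
  exists2 u : g, u \in jj g & vsval (qrepr (qpi jj_in_perp x)) = vsval x + u.
Proof.
exists (vsval (qrepr (qpi jj_in_perp x)) - vsval x); last by rewrite addrC subrK.
have : qrepr (qpi jj_in_perp x) - x \in jj_in_perp by apply/qpiP; rewrite qreprK.
by rewrite mem_jj_in_perp linearB.
Qed.

Let brj (u X : g) : u \in jj g -> br u X = 0.
Proof. by rewrite memv_cap => /andP[/centerP ->]. Qed.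

Let brj' (u X : g) : u \in jj g -> br X u = 0.
Proof. by move=> uj; rewrite brC brj ?oppr0. Qed.

Let omj (u : g) (x : W) : u \in jj g -> om u (vsval x) = 0.
Proof. by move=> uj; rewrite om_skew; have /perpP -> := subvsP x; rewrite ?oppr0. Qed.

Let omjj (u v : g) : u \in jj g -> v \in jj g -> om u v = 0.
Proof.
rewrite !memv_cap => /andP[_ /perpP H] /andP[vc _]; exact: H.
Qed.

Let brE0 (x y : W) :
  br (vsval (qrepr (qpi jj_in_perp x))) (vsval (qrepr (qpi jj_in_perp y))) =
  br (vsval x) (vsval y).
Proof.
have [u uj ->] := reprE x; have [v vj ->] := reprE y.
by rewrite !linearD /= !add_lfunE !(brj' _ vj) !(brj _ uj) !addr0.
Qed.

Let omE0 (x y : W) :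
  om (vsval (qrepr (qpi jj_in_perp x))) (vsval (qrepr (qpi jj_in_perp y))) =
  om (vsval x) (vsval y).
Proof.
have [u uj ->] := reprE x; have [v vj ->] := reprE y.
rewrite !linearD /= !add_lfunE (omjj uj vj) (omj _ uj) addr0.
by rewrite (om_skew (vsval x) v) (omj _ vj) oppr0 !addr0.
Qed.

Lemma red_brE (x y : W) :
  red_br (qpi _ x) (qpi _ y) = qpi _ (vsproj _ (br (vsval x) (vsval y))).
Proof.
rewrite bilfunE ?brE0 //.
  move=> q k p1 p2; elim/q_ind: q => z; elim/q_ind: p1 => x1; elim/q_ind: p2 => x2.
  rewrite -linearP !brE0 -linearP -linearP; congr (qpi _ (vsproj _ _)).
  by rewrite !linearP /= !lfunE /= !lfunE.
move=> q k p1 p2; elim/q_ind: q => z; elim/q_ind: p1 => x1; elim/q_ind: p2 => x2.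
by rewrite -linearP !brE0 -linearP -linearP; congr (qpi _ (vsproj _ _)); rewrite !linearP.
Qed.

Lemma red_omE (x y : W) :
  red_om (qpi _ x) (qpi _ y) = om (vsval x) (vsval y).
Proof.
rewrite bilfunE ?omE0 //.
  move=> q k p1 p2; elim/q_ind: q => z; elim/q_ind: p1 => x1; elim/q_ind: p2 => x2.
  by rewrite -linearP !omE0 !linearP /= !lfunE /= !lfunE.
move=> q k p1 p2; elim/q_ind: q => z; elim/q_ind: p1 => x1; elim/q_ind: p2 => x2.
by rewrite -linearP !omE0 !linearP.
Qed.

Let valbr (x y : W) :
  vsval (vsproj (perp (jj g)) (br (vsval x) (vsval y))) = br (vsval x) (vsval y).
Proof. by rewrite vsprojK // br_in_perp ?subvsP. Qed.

Fact red_brxx p : red_br p p = 0.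
Proof. by elim/q_ind: p => x; rewrite red_brE brxx !linear0. Qed.

Fact red_jacobi p q r :
  red_br p (red_br q r) + red_br q (red_br r p) + red_br r (red_br p q) = 0.
Proof.
elim/q_ind: p => x; elim/q_ind: q => y; elim/q_ind: r => z.
by rewrite !red_brE !valbr -!linearD jacobi !linear0.
Qed.

Fact red_om_skew p q : red_om p q = - red_om q p.
Proof.
by elim/q_ind: p => x; elim/q_ind: q => y; rewrite !red_omE om_skew.
Qed.

Fact red_om_nondeg p : (forall q, red_om p q = 0) -> p = 0.
Proof.
elim/q_ind: p => x H; rewrite -(linear0 (qpi jj_in_perp)); apply/qpiP.
rewrite subr0 mem_jj_in_perp.
suff : vsval x \in perp (perp (jj g)) by rewrite perpK.
apply/perpP => Y Yj.
by have := H (qpi _ (Subvs Yj)); rewrite red_omE.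
Qed.

Fact red_om_closed p q r :
  red_om (red_br p q) r + red_om (red_br q r) p + red_om (red_br r p) q = 0.
Proof.
elim/q_ind: p => x; elim/q_ind: q => y; elim/q_ind: r => z.
by rewrite !red_brE !red_omE !valbr om_closed.
Qed.

(* [j^perp / j] with the induced bracket and form. *)
Definition reduction : symplLie R :=
  SymplLie red_brxx red_jacobi red_om_skew red_om_nondeg red_om_closed.

End Reduction.

Section Cocycles.
Variables (R : realType) (l : vectType R) (a : symplLie R).

Local Notation ldual := 'Hom(l, R^o).

Record triple := Triple {
  gam : 'Hom(l, 'Hom(a, ldual));
  eps : 'Hom(l, 'Hom(l, ldual));
  xi  : 'Hom(l, 'End(a)) }.

Implicit Types (t : triple) (tau : 'Hom(l, a)).

Definition alpha t : 'Hom(l, 'Hom(l, a)) :=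
  bilfun (fun L1 L2 =>
    sharp a (linfun (fun A : a => gam t L1 A L2 - gam t L2 A L1 : R^o))).

Definition beta t : 'Hom(a, 'Hom(a, ldual)) :=
  bilfun (fun A1 A2 =>
    linfun (fun L : l => - om (xi t L A1) A2 - om A1 (xi t L A2) : R^o)).

Lemma alphaE t L1 L2 A :
  om (alpha t L1 L2) A = gam t L1 A L2 - gam t L2 A L1.
Proof. by rewrite bilfunE ?sharpK ?linfunE //; lin. Qed.

Lemma betaE t A1 A2 L :
  beta t A1 A2 L = - om (xi t L A1) A2 - om A1 (xi t L A2).
Proof. by rewrite bilfunE ?linfunE //; lin. Qed.

(* [eps] is required to be alternating here, not in the type [triple]. *)
Record Z2 t : Prop := InZ2 {
  Z2_eps_alt : forall L, eps t L L = 0;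
  Z2_xi_der : forall L A1 A2,
    xi t L (br A1 A2) = br (xi t L A1) A2 + br A1 (xi t L A2);
  Z2_xi_comm : forall L1 L2 A,
    xi t L1 (xi t L2 A) - xi t L2 (xi t L1 A) = br (alpha t L1 L2) A;
  Z2_xi_alpha : forall L1 L2 L3,
    xi t L1 (alpha t L2 L3) + xi t L2 (alpha t L3 L1)
    + xi t L3 (alpha t L1 L2) = 0;
  Z2_gam_br : forall L A1 A2,
    beta t (xi t L A1) A2 + beta t A1 (xi t L A2) = gam t L (br A1 A2);
  Z2_gam_xi : forall L1 L2 A,
    gam t L2 (xi t L1 A) - gam t L1 (xi t L2 A) + beta t (alpha t L1 L2) A = 0;
  Z2_gam_alpha : forall L1 L2 L3,
    gam t L1 (alpha t L2 L3) + gam t L2 (alpha t L3 L1)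
    + gam t L3 (alpha t L1 L2) = 0;
  Z2_eps_cyc : forall L1 L2 L3,
    eps t L1 L2 L3 + eps t L2 L3 L1 + eps t L3 L1 L2 = 0 }.

Definition Z2sharp_a t : Prop := forall L,
  (exists A : a,
    [/\ forall A', br A A' + xi t L A' = 0,
        forall A', gam t L A' + beta t A A' = 0,
        forall L', alpha t L L' = xi t L' A
      & forall L', eps t L L' = gam t L' A]) ->
  L = 0.

Definition Z2sharp_b t : Prop :=
  let N := [set A : a | [/\ A \in center a,
                            forall A', beta t A A' = 0,
                            forall L, xi t L A = 0
                          & forall L, gam t L A = 0]] in
  forall A, N A -> (forall B, N B -> om A B = 0) -> A = 0.

Definition Z2sharp : set triple :=
  [set t | [/\ Z2 t, Z2sharp_a t & Z2sharp_b t]].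

Definition tstar tau : 'Hom(a, ldual) :=
  bilfun (fun (A : a) (L : l) => om (tau L) A : R^o).

Definition act t tau : triple := {|
  gam := bilfun (fun L A =>
    gam t L A + tstar tau (xi t L A) - tstar tau (br (tau L) A)
    - beta t (tau L) A);
  eps := bilfun (fun L1 L2 =>
    eps t L1 L2 + tstar tau (alpha t L1 L2)
    - gam t L1 (tau L2) + gam t L2 (tau L1)
    - tstar tau (xi t L1 (tau L2) - xi t L2 (tau L1))
    + tstar tau (br (tau L1) (tau L2)) + beta t (tau L1) (tau L2));
  xi := bilfun (fun L A => xi t L A - br (tau L) A) |}.

Definition cohom_class t : set triple := [set act t tau | tau in setT].

Definition H2sharp : set (set triple) := [set cohom_class t | t in Z2sharp].

Definition Ggroup : set ('End(l) * 'End(a)) :=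
  [set p : 'End(l) * 'End(a) | bijective p.1 /\ sympl_iso p.2].

Definition pull (p : 'End(l) * 'End(a)) t : triple := {|
  gam := bilfun (fun L A => (gam t (p.1 L) ((p.2^-1)%VF A) \o p.1)%VF);
  eps := bilfun (fun L1 L2 => (eps t (p.1 L1) (p.1 L2) \o p.1)%VF);
  xi := bilfun (fun L A => p.2 (xi t (p.1 L) ((p.2^-1)%VF A))) |}.

(* The action on classes: [pullH p (cohom_class t) = cohom_class (pull p t)],
   see [pullH_class]. *)
Definition pullH (p : 'End(l) * 'End(a)) (c : set triple) : set triple :=
  [set pull p t | t in c].

Definition Gorbit (c : set triple) : set (set triple) :=
  [set pullH p c | p in Ggroup].

Definition H2sharp_mod_G : set (set (set triple)) :=
  [set Gorbit c | c in H2sharp].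

Lemma tstarE tau A L : tstar tau A L = om (tau L) A.
Proof. by rewrite bilfunE //; lin. Qed.

Lemma xi_actE t tau L A : xi (act t tau) L A = xi t L A - br (tau L) A.
Proof. by rewrite bilfunE //; lin. Qed.

Lemma gam_actE t tau L A :
  gam (act t tau) L A =
  gam t L A + tstar tau (xi t L A) - tstar tau (br (tau L) A)
  - beta t (tau L) A.
Proof. by rewrite bilfunE //; lin. Qed.

Lemma eps_actE t tau L1 L2 :
  eps (act t tau) L1 L2 =
  eps t L1 L2 + tstar tau (alpha t L1 L2)
  - gam t L1 (tau L2) + gam t L2 (tau L1)
  - tstar tau (xi t L1 (tau L2) - xi t L2 (tau L1))
  + tstar tau (br (tau L1) (tau L2)) + beta t (tau L1) (tau L2).
Proof. by rewrite bilfunE //; lin. Qed.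

Lemma gam_pullE p t L1 A L2 :
  gam (pull p t) L1 A L2 = gam t (p.1 L1) ((p.2^-1)%VF A) (p.1 L2).
Proof. by rewrite bilfunE ?comp_lfunE //; lin. Qed.

Lemma eps_pullE p t L1 L2 L3 :
  eps (pull p t) L1 L2 L3 = eps t (p.1 L1) (p.1 L2) (p.1 L3).
Proof. by rewrite bilfunE ?comp_lfunE //; lin. Qed.

Lemma xi_pullE p t L A :
  xi (pull p t) L A = p.2 (xi t (p.1 L) ((p.2^-1)%VF A)).
Proof. by rewrite bilfunE //; lin. Qed.

Lemma om_inj (A B : a) : (forall C, om A C = om B C) -> A = B.
Proof.
move=> H; apply/eqP; rewrite -subr_eq0; apply/eqP/om_nondeg => C.
by rewrite linearB add_lfunE opp_lfunE H subrr.
Qed.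

Lemma alphaC t L1 L2 : alpha t L1 L2 = - alpha t L2 L1.
Proof.
apply: om_inj => C; rewrite linearN opp_lfunE !alphaE; lra.
Qed.

Lemma betaC t A1 A2 : beta t A1 A2 = - beta t A2 A1.
Proof.
apply/lfunP => L; rewrite opp_lfunE !betaE.
by rewrite (om_skew A2) (om_skew _ A1); lra.
Qed.

Lemma beta_cyc t A1 A2 A3 : Z2 t ->
  beta t A1 (br A2 A3) + beta t A2 (br A3 A1) + beta t A3 (br A1 A2) = 0.
Proof.
case=> _ der _ _ _ _ _ _; apply/lfunP => L.
rewrite !add_lfunE zero_lfunE !betaE !der !linearD /=.
have := om_closed (xi t L A1) A2 A3; have := om_closed (xi t L A2) A3 A1.
have := om_closed (xi t L A3) A1 A2.
rewrite !(brC _ (xi t L _)) !linearN /= !opp_lfunE.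
rewrite !(om_skew (xi t L _)) !(om_skew (br _ _) A1) !(om_skew (br _ _) A2).
rewrite !(om_skew (br _ _) A3); lra.
Qed.

End Cocycles.

Section GAction.
Variables (R : realType) (l : vectType R) (a : symplLie R).
Implicit Types (t : triple l a) (tau : 'Hom(l, a)).
Variable p : 'End(l) * 'End(a).
Hypothesis Gp : Ggroup p.

Local Notation S := p.1.
Local Notation U := p.2.
Local Notation V := (p.2^-1)%VF.

Let S0 : lker S == 0%VS.
Proof. by apply/lker0P; case: Gp => /bij_inj. Qed.

Let U0 : lker U == 0%VS.
Proof. by apply/lker0P; case: Gp => _ [/bij_inj]. Qed.

Let VK A : U (V A) = A. Proof. exact: lker0_lfunVK. Qed.

Let omU A B : om (U A) B = om A (V B).
Proof. by case: Gp => _ [_ _ H]; rewrite -{1}(VK B) H. Qed.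

Let omU' A B : om A (U B) = om (V A) B.
Proof. by rewrite om_skew omU om_skew opprK. Qed.

Let brU A B : br (U A) B = U (br A (V B)).
Proof. by case: Gp => _ [_ H _]; rewrite -{1}(VK B) H. Qed.

Lemma alpha_pullE t L1 L2 : alpha (pull p t) L1 L2 = U (alpha t (S L1) (S L2)).
Proof. by apply: om_inj => C; rewrite omU !alphaE !gam_pullE. Qed.

Lemma beta_pullE t A1 A2 L :
  beta (pull p t) A1 A2 L = beta t (V A1) (V A2) (S L).
Proof. by rewrite !betaE !xi_pullE omU omU'. Qed.

Let sg tau : 'Hom(l, a) := (U \o tau \o S)%VF.

Let sgE tau L : sg tau L = U (tau (S L)).
Proof. by rewrite !comp_lfunE. Qed.

Let tstar_sg tau A L : tstar (sg tau) A L = tstar tau (V A) (S L).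
Proof. by rewrite !tstarE sgE omU. Qed.

Let UK A : V (U A) = A. Proof. exact: lker0_lfunK. Qed.

Let ev4 (x y z w : 'Hom(l, R^o)) L : (x + y - z - w) L = x L + y L - z L - w L.
Proof. by rewrite !(add_lfunE, opp_lfunE). Qed.

Let ev7 (x y z w u v q : 'Hom(l, R^o)) L :
  (x + y - z + w - u + v + q) L = x L + y L - z L + w L - u L + v L + q L.
Proof. by rewrite !(add_lfunE, opp_lfunE). Qed.

Lemma triple_eq t1 t2 :
  (forall L A M, gam t1 L A M = gam t2 L A M) ->
  (forall L M N, eps t1 L M N = eps t2 L M N) ->
  (forall L A, xi t1 L A = xi t2 L A) -> t1 = t2.
Proof.
case: t1 t2 => [g1 e1 x1] [g2 e2 x2] /= Hg He Hx; congr Triple.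
- by apply/lfunP => L; apply/lfunP => A; apply/lfunP => M.
- by apply/lfunP => L; apply/lfunP => A; apply/lfunP => M.
- by apply/lfunP => L; apply/lfunP => A.
Qed.

Lemma pull_act t tau :
  pull p (act t tau) = act (pull p t) (p.2 \o tau \o p.1)%VF.
Proof.
apply: triple_eq => [L A M|L M N|L A].
- rewrite (gam_pullE p (act t tau)) (gam_actE t tau).
  rewrite (gam_actE (pull p t) (sg tau)).
  rewrite ev4.
  rewrite ev4.
  rewrite (gam_pullE p t L A M).
  rewrite (beta_pullE t _ A M).
  rewrite (tstar_sg tau _ M).
  rewrite (tstar_sg tau _ M).
  rewrite (sgE tau L).
  by rewrite (brU _ A) (xi_pullE p t L A) !UK.
- rewrite (eps_pullE p (act t tau)) (eps_actE t tau).
  rewrite (eps_actE (pull p t) (sg tau)).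
  rewrite ev7.
  rewrite ev7.
  rewrite (eps_pullE p t L M N).
  rewrite (gam_pullE p t L (sg tau M) N) (gam_pullE p t M (sg tau L) N).
  rewrite (beta_pullE t _ _ N).
  rewrite !(tstar_sg tau _ N).
  rewrite (sgE tau L) (sgE tau M).
  rewrite (xi_pullE p t L) (xi_pullE p t M) (alpha_pullE t L M).
  by rewrite (brU (tau (S L))) -(linearB U) !UK.
- by rewrite xi_pullE !xi_actE -/(sg tau) xi_pullE sgE brU linearB.
Qed.

Lemma pullH_class t : pullH p (cohom_class t) = cohom_class (pull p t).
Proof.
apply/seteqP; split => [_ [_ [tau _ <-] <-]|_ [tau _ <-]].
  by exists (p.2 \o tau \o p.1)%VF; rewrite ?pull_act.
exists (act t (p.2^-1 \o tau \o p.1^-1)%VF).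
  by exists (p.2^-1 \o tau \o p.1^-1)%VF.
rewrite pull_act; congr act; apply/lfunP => L; rewrite !comp_lfunE VK.
by rewrite lker0_lfunK.
Qed.

End GAction.

Section Extension.
Variables (R : realType) (l : vectType R) (a : symplLie R) (t : triple l a).
Hypothesis Zt : Z2 t.

(* [l^* + a + l], an element [((Z, A), L)] standing for [Z + A + L]. *)
Definition ext_space : vectType R := ('Hom(l, R^o) * a * l)%type.

Definition ext_br : 'Hom(ext_space, 'End(ext_space)) :=
  bilfun (fun X Y : ext_space =>
    ((beta t X.1.2 Y.1.2 + gam t X.2 Y.1.2 - gam t Y.2 X.1.2 + eps t X.2 Y.2,
      br X.1.2 Y.1.2 + xi t X.2 Y.1.2 - xi t Y.2 X.1.2 + alpha t X.2 Y.2),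
     0) : ext_space).

Definition ext_om : 'Hom(ext_space, 'Hom(ext_space, R^o)) :=
  bilfun (fun X Y : ext_space =>
    X.1.1 Y.2 + om X.1.2 Y.1.2 - Y.1.1 X.2 : R^o).

Lemma ext_brE X Y :
  ext_br X Y =
    ((beta t X.1.2 Y.1.2 + gam t X.2 Y.1.2 - gam t Y.2 X.1.2 + eps t X.2 Y.2,
      br X.1.2 Y.1.2 + xi t X.2 Y.1.2 - xi t Y.2 X.1.2 + alpha t X.2 Y.2),
     0).
Proof. by rewrite /ext_br bilfunE //; lin. Qed.

Lemma ext_omE X Y : ext_om X Y = X.1.1 Y.2 + om X.1.2 Y.1.2 - Y.1.1 X.2.
Proof. by rewrite /ext_om bilfunE //; lin. Qed.

Fact ext_brxx X : ext_br X X = 0.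
Proof.
rewrite ext_brE !brxx (Z2_eps_alt Zt).
have -> : beta t X.1.2 X.1.2 = 0.
  by apply/lfunP => L; rewrite betaE (om_skew X.1.2) zero_lfunE; lra.
have -> : alpha t X.2 X.2 = 0.
  by apply: om_inj => C; rewrite alphaE subrr linear0 zero_lfunE.
by rewrite !add0r !subrr !addr0.
Qed.

Let epsC L1 L2 : eps t L1 L2 = - eps t L2 L1.
Proof.
have := Z2_eps_alt Zt (L1 + L2).
rewrite !linearD /= !add_lfunE !(Z2_eps_alt Zt) addr0 add0r => /eqP.
by rewrite addrC addr_eq0 => /eqP.
Qed.

Let ext_eq (X Y : ext_space) :
  X.1.1 = Y.1.1 -> X.1.2 = Y.1.2 -> X.2 = Y.2 -> X = Y.
Proof. by case: X Y => [[? ?] ?] [[? ?] ?] /= -> -> ->. Qed.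

Let hom4 (U V : vectType R) (h : 'Hom(U, V)) x y z w :
  h (x + y - z + w) = h x + h y - h z + h w.
Proof. by rewrite !linearD linearN. Qed.

Let eval4 (V : vectType R) (x y z w : 'Hom(V, R^o)) L :
  (x + y - z + w) L = x L + y L - z L + w L.
Proof. by rewrite !(add_lfunE, opp_lfunE). Qed.

Let ldual_jacobi A1 A2 A3 L1 L2 L3 :
  let W Ai Li Aj Lj := br Ai Aj + xi t Li Aj - xi t Lj Ai + alpha t Li Lj in
  let C Ai Li w := beta t Ai w + gam t Li w in
  C A1 L1 (W A2 L2 A3 L3) + C A2 L2 (W A3 L3 A1 L1)
  + C A3 L3 (W A1 L1 A2 L2) = 0.
Proof.
move=> W C; apply/lfunP => L.
have CE A M B N B' N' : C A M (W B N B' N') L =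
    (beta t A (br B B') L + beta t A (xi t N B') L - beta t A (xi t N' B) L
      + beta t A (alpha t N N') L)
    + (gam t M (br B B') L + gam t M (xi t N B') L - gam t M (xi t N' B) L
      + gam t M (alpha t N N') L).
  by rewrite /C /W add_lfunE !hom4 !eval4.
have bC A B : beta t A B L = - beta t B A L by rewrite betaC opp_lfunE.
have F1 : beta t A1 (br A2 A3) L + beta t A2 (br A3 A1) L
    + beta t A3 (br A1 A2) L = 0.
  by rewrite -!add_lfunE beta_cyc // zero_lfunE.
have F2 : gam t L1 (alpha t L2 L3) L + gam t L2 (alpha t L3 L1) L
    + gam t L3 (alpha t L1 L2) L = 0.
  by rewrite -!add_lfunE Z2_gam_alpha // zero_lfunE.
have G M B D : gam t M (br B D) L = beta t B (xi t M D) L - beta t D (xi t M B) L.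
  by rewrite -Z2_gam_br // add_lfunE (bC (xi t M B)) addrC.
have H M N B : gam t M (xi t N B) L =
    gam t N (xi t M B) L - beta t (alpha t N M) B L.
  apply/eqP; rewrite -subr_eq0 opprB addrA; apply/eqP.
  have := congr1 (fun f : 'Hom(l, R^o) => f L) (Z2_gam_xi Zt N M B).
  rewrite !add_lfunE opp_lfunE zero_lfunE => <-; lra.
rewrite 2!add_lfunE zero_lfunE !CE.
move: (G L1 A2 A3) (G L2 A3 A1) (G L3 A1 A2).
move: (H L1 L2 A3) (H L2 L3 A1) (H L3 L1 A2).
move: (bC (alpha t L2 L1) A3) (bC (alpha t L3 L2) A1) (bC (alpha t L1 L3) A2).
have aC A M N : beta t A (alpha t M N) L = - beta t A (alpha t N M) L.
  by rewrite alphaC linearN opp_lfunE.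
move: (aC A3 L1 L2) (aC A1 L2 L3) (aC A2 L3 L1) F1 F2.
clear; lra.
Qed.

Let a_jacobi A1 A2 A3 L1 L2 L3 :
  let W Ai Li Aj Lj := br Ai Aj + xi t Li Aj - xi t Lj Ai + alpha t Li Lj in
  let C Ai Li w := br Ai w + xi t Li w in
  C A1 L1 (W A2 L2 A3 L3) + C A2 L2 (W A3 L3 A1 L1)
  + C A3 L3 (W A1 L1 A2 L2) = 0.
Proof.
move=> W C; apply: om_inj => X.
have CE A M B N B' N' : om (C A M (W B N B' N')) X =
    (om (br A (br B B')) X + om (br A (xi t N B')) X
      - om (br A (xi t N' B)) X + om (br A (alpha t N N')) X)
    + (om (xi t M (br B B')) X + om (xi t M (xi t N B')) X
      - om (xi t M (xi t N' B)) X + om (xi t M (alpha t N N')) X).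
  by rewrite /C /W linearD /= !hom4 !(add_lfunE, opp_lfunE).
have oD Y Z : om (Y + Z) X = om Y X + om Z X by rewrite linearD add_lfunE.
have oN Y : om (- Y) X = - om Y X by rewrite linearN opp_lfunE.
have o0 : om 0 X = 0 by rewrite linear0 zero_lfunE.
have bC A B : om (br A B) X = - om (br B A) X by rewrite brC oN.
have F1 : om (br A1 (br A2 A3)) X + om (br A2 (br A3 A1)) X
    + om (br A3 (br A1 A2)) X = 0 by rewrite -!oD jacobi.
have F2 : om (xi t L1 (alpha t L2 L3)) X + om (xi t L2 (alpha t L3 L1)) X
    + om (xi t L3 (alpha t L1 L2)) X = 0 by rewrite -!oD Z2_xi_alpha.
have G M B D : om (xi t M (br B D)) X =
    om (br B (xi t M D)) X - om (br D (xi t M B)) X.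
  by rewrite Z2_xi_der // oD (bC (xi t M B)) addrC.
have H M N B : om (xi t M (xi t N B)) X =
    om (xi t N (xi t M B)) X - om (br B (alpha t M N)) X.
  have := congr1 (fun f => om f X) (Z2_xi_comm Zt M N B).
  rewrite oD oN (bC (alpha t M N)); lra.
rewrite 2!oD o0 !CE.
move: (G L1 A2 A3) (G L2 A3 A1) (G L3 A1 A2).
move: (H L1 L2 A3) (H L2 L3 A1) (H L3 L1 A2) F1 F2.
clear; lra.
Qed.

Fact ext_jacobi X Y Z :
  ext_br X (ext_br Y Z) + ext_br Y (ext_br Z X) + ext_br Z (ext_br X Y) = 0.
Proof.
have E P Q S : ext_br P (ext_br Q S) =
  let w := br Q.1.2 S.1.2 + xi t Q.2 S.1.2 - xi t S.2 Q.1.2 + alpha t Q.2 S.2 in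
  ((beta t P.1.2 w + gam t P.2 w, br P.1.2 w + xi t P.2 w), 0).
  rewrite (ext_brE Q) ext_brE /= (linear0 (gam t)) (linear0 (xi t)).
  by rewrite (linear0 (eps t P.2)) (linear0 (alpha t P.2)) !zero_lfunE !subr0 !addr0.
rewrite !E; apply: ext_eq => /=; last by rewrite !addr0.
  exact: ldual_jacobi.
exact: a_jacobi.
Qed.

Fact ext_om_skew X Y : ext_om X Y = - ext_om Y X.
Proof. rewrite !ext_omE (om_skew X.1.2); lra. Qed.

Fact ext_om_nondeg X : (forall Y, ext_om X Y = 0) -> X = 0.
Proof.
case: X => [[Z A] L] H; apply: ext_eq => /=.
- apply/lfunP => M; have := H (0, 0, M).
  by rewrite ext_omE /= linear0 !zero_lfunE addr0 subr0.
- apply: om_nondeg => B; have := H (0, B, 0).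
  by rewrite ext_omE /= linear0 !zero_lfunE add0r subr0.
rewrite (coord_vbasis (memvf L)); apply: big1 => i _.
suff -> : coord (vbasis fullv) i L = 0 by rewrite scale0r.
have := H (linfun (coord (vbasis fullv) i : l -> R^o), 0, 0).
rewrite ext_omE /= !linear0 lfunE add0r => /eqP.
by rewrite sub0r oppr_eq0 => /eqP.
Qed.

Fact ext_om_closed X Y Z :
  ext_om (ext_br X Y) Z + ext_om (ext_br Y Z) X + ext_om (ext_br Z X) Y = 0.
Proof.
have E P Q S : ext_om (ext_br P Q) S =
  (beta t P.1.2 Q.1.2 S.2 + gam t P.2 Q.1.2 S.2 - gam t Q.2 P.1.2 S.2
    + eps t P.2 Q.2 S.2)
  + (om (br P.1.2 Q.1.2) S.1.2 + om (xi t P.2 Q.1.2) S.1.2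
    - om (xi t Q.2 P.1.2) S.1.2 + om (alpha t P.2 Q.2) S.1.2).
  by rewrite ext_omE ext_brE /= linear0 subr0 eval4 hom4 eval4.
rewrite !E !betaE !alphaE.
case: X Y Z => [[Z1 A1] L1] [[Z2 A2] L2] [[Z3 A3] L3] /=.
move: (om_closed A1 A2 A3) (Z2_eps_cyc Zt L1 L2 L3).
have S M A B : om A (xi t M B) = - om (xi t M B) A by exact: om_skew.
move: (S L3 A1 A2) (S L1 A2 A3) (S L2 A3 A1).
clear; lra.
Qed.

(* The symplectic Lie algebra [d_{gam, eps, xi}(l, a)]. *)
Definition extension : symplLie R :=
  SymplLie ext_brxx ext_jacobi ext_om_skew ext_om_nondeg ext_om_closed.

End Extension.

(* [set] and [set_bij] live in a universe below that of [symplLie R], so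
   families of symplectic Lie algebras are plain predicates. *)
Definition bij_on (T U : Type) (A : T -> Prop) (B : U -> Prop) (f : T -> U) :
    Prop :=
  [/\ forall x, A x -> B (f x),
      forall x y, A x -> A y -> f x = f y -> x = y
    & forall y, B y -> exists2 x, A x & f x = y].

Section Classes.
Variable R : realType.

Definition iso_class (g : symplLie R) : symplLie R -> Prop :=
  fun h => isomorphic g h.

Definition iso_classes (P : symplLie R -> Prop) :
    (symplLie R -> Prop) -> Prop :=
  fun C => exists2 g, P g & C = iso_class g.

Definition repr_system (d : nat) (I : symplLie R -> Prop) : Prop :=
  (forall a, I a -> \dim {:a} = d) /\
  (forall g : symplLie R, \dim {:g} = d ->
    exists! a, I a /\ isomorphic g a).

Definition coprod_type : Type :=
  {m : nat & {a : symplLie R & set (set (triple 'rV[R]_m a))}}.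

Definition coprod_elt (m : nat) (a : symplLie R)
    (o : set (set (triple 'rV[R]_m a))) : coprod_type :=
  existT _ m (existT _ a o).

(* The coproduct over [1 <= m <= n] and [a] in [Isom (2n - 2m)] of the orbit
   spaces [H^2(R^m, a)_sharp / G]. *)
Definition coprod_H2 (Isom : nat -> symplLie R -> Prop) (n : nat) :
    coprod_type -> Prop :=
  fun x => exists m a o,
    [/\ x = @coprod_elt m a o, (1 <= m <= n)%N,
        Isom (2 * n - 2 * m)%N a & H2sharp_mod_G o].

End Classes.

(* Main.v *)
Require Import Defs.
From mathcomp Require Import all_boot all_order all_algebra.
From mathcomp Require Import boolp classical_sets reals.
From mathcomp Require Import lra zify.
Import GRing.Theory Num.Theory.
Set Implicit Arguments.
Unset Strict Implicit.
Local Open Scope ring_scope.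

(** The structure of [d_{gamma, epsilon, xi}(l, a)] is encoded in the trilinear
    form [om([X, Y], W)] restricted to the three blocks [l^*], [a], [l]: closedness
    of [om] and centrality of [l^*] reduce it to the data [gamma], [epsilon], [xi]
    and the bracket of [a]. Hence a linear bijection [l^* + a + l -> g] that is
    symplectic, maps [l^*] into the center and matches these restricted trilinear
    forms (a "frame") forces [(gamma, epsilon, xi)] to be a cocycle and is an
    isomorphism of symplectic Lie algebras.

    Conditions (a) and (b) of a sharp cocycle say exactly that
    [z cap z^perp = l^*] in the extension. So an isomorphism between two sharp
    extensions preserves the flag [l^*], [l^* + a], and its diagonal blocks [U], [S]
    and the off-diagonal block [l -> a] give the element of [G] and the cochain
    relating the two cocycles; conversely these data define a frame. Finally, every
    [g] has a frame: lift [j^perp / j] to [j^perp], choose a complement of [j^perp],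
    and correct both by [j]-valued maps so that they become orthogonal and the
    complement isotropic. *)

(** Coordinate functionals separate vectors. Serves to kill an [l]-component by pairing it with
    every element of [l^*]. *)
Lemma dual_eq0 (K : fieldType) (V : vectType K) (v : V) :
  (forall f : 'Hom(V, K^o), f v = 0) -> v = 0.
Proof.
move=> H; rewrite (coord_vbasis (memvf v)); apply: big1 => i _.
have := H (linfun (coord (vbasis fullv) i : V -> K^o)).
by rewrite lfunE /= => ->; rewrite scale0r.
Qed.

(** * Isomorphisms of symplectic Lie algebras and the invariance of [j] *)

Section Isomorphisms.
Variable R : realType.
Implicit Types g h k : symplLie R.

Lemma omNl g (X Y : g) : om (- X) Y = - om X Y.
Proof. by rewrite linearN opp_lfunE. Qed.

Lemma omNr g (X Y : g) : om X (- Y) = - om X Y.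
Proof. by rewrite linearN. Qed.

Lemma brNl g (X Y : g) : br (- X) Y = - br X Y.
Proof. by rewrite linearN opp_lfunE. Qed.

Lemma brNr g (X Y : g) : br X (- Y) = - br X Y.
Proof. by rewrite linearN. Qed.

(** Injectivity is automatic: a vector of the kernel is orthogonal to everything because the form is
    preserved, and the form is non-degenerate. *)
Lemma sympl_iso_surj g h (phi : 'Hom(g, h)) :
  limg phi = fullv ->
  (forall X Y, phi (br X Y) = br (phi X) (phi Y)) ->
  (forall X Y, om (phi X) (phi Y) = om X Y) -> sympl_iso phi.
Proof.
move=> surj hb ho; split=> //; exists (phi^-1)%VF => X; last first.
  by apply: limg_lfunVK; rewrite surj memvf.
apply: lker0_lfunK; apply/eqP/vspaceP => Y; rewrite memv_ker memv0.
apply/eqP/eqP => [H|->]; last by rewrite linear0.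
by apply: om_nondeg => Z; rewrite -ho H linear0 zero_lfunE.
Qed.

Lemma isomorphic_refl g : isomorphic g g.
Proof.
exists \1%VF; split=> [|X Y|X Y]; rewrite ?id_lfunE //.
by exists id => X; rewrite id_lfunE.
Qed.

Lemma sympl_iso_inv g h (phi : 'Hom(g, h)) : sympl_iso phi ->
  cancel phi (phi^-1)%VF /\ cancel (phi^-1)%VF phi.
Proof.
case=> [[psi K K'] _ _].
have E X : (phi^-1)%VF (phi X) = X by apply/lker0_lfunK/lker0P/(can_inj K).
by split=> // Y; rewrite -(K' Y) E.
Qed.

Lemma isomorphic_sym g h : isomorphic g h -> isomorphic h g.
Proof.
case=> phi iso; have [K K'] := sympl_iso_inv iso; case: iso => _ hb ho.
exists (phi^-1)%VF; split=> [|X Y|X Y].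
- by exists phi.
- by apply: (can_inj K); rewrite hb !K'.
- by rewrite -ho !K'.
Qed.

Lemma isomorphic_trans g h k : isomorphic g h -> isomorphic h k -> isomorphic g k.
Proof.
case=> phi [pb pbr pom] [psi [qb qbr qom]].
exists (psi \o phi)%VF; split=> [|X Y|X Y]; rewrite ?comp_lfunE ?pbr ?qbr ?qom ?pom //.
by apply: (eq_bij (bij_comp qb pb)) => X; rewrite comp_lfunE.
Qed.

Lemma iso_classP g h : iso_class g = iso_class h <-> isomorphic g h.
Proof.
split=> [e|gh].
  by rewrite -[isomorphic g h]/(iso_class g h) e; exact: isomorphic_refl.
apply/funext => k; apply/propext; split; apply: isomorphic_trans => //.
exact: isomorphic_sym.
Qed.

Lemma sympl_iso_center g h (phi : 'Hom(g, h)) X : sympl_iso phi ->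
  (phi X \in center h) = (X \in center g).
Proof.
move=> iso; have [K K'] := sympl_iso_inv iso; case: iso => _ hb ho.
apply/centerP/centerP => H Y; last by rewrite -(K' Y) -hb H linear0.
by apply: (can_inj K); rewrite hb H linear0.
Qed.

Lemma sympl_iso_jj g h (phi : 'Hom(g, h)) X : sympl_iso phi ->
  (phi X \in jj h) = (X \in jj g).
Proof.
move=> iso; have [K K'] := sympl_iso_inv iso; have [_ hb ho] := iso.
rewrite !memv_cap (sympl_iso_center X iso); congr (_ && _).
apply/perpP/perpP => H Y Yc; last first.
  by rewrite -(K' Y) ho H // -(sympl_iso_center _ iso) K'.
by rewrite -ho H // (sympl_iso_center _ iso).
Qed.

Lemma sympl_iso_dim g h (phi : 'Hom(g, h)) (W : {vspace g}) :
  sympl_iso phi -> \dim (phi @: W) = \dim W.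
Proof.
move=> iso; have [K _] := sympl_iso_inv iso.
by apply: limg_dim_eq; rewrite (eqP (introT lker0P (can_inj K))) capv0.
Qed.

Lemma isomorphic_dim g h : isomorphic g h -> \dim {:g} = \dim {:h}.
Proof.
case=> phi iso; rewrite -(sympl_iso_dim fullv iso); congr (\dim _).
have [K K'] := sympl_iso_inv iso.
apply/vspaceP => Y; rewrite memvf.
by rewrite -(K' Y) memv_img ?memvf.
Qed.

Lemma isomorphic_dim_jj g h : isomorphic g h -> \dim (jj g) = \dim (jj h).
Proof.
case=> phi iso; rewrite -(sympl_iso_dim (jj g) iso); congr (\dim _).
have [K K'] := sympl_iso_inv iso.
apply/vspaceP => Y; apply/memv_imgP/idP => [[X Xj ->]|Yj].
  by rewrite (sympl_iso_jj _ iso).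
by exists ((phi^-1)%VF Y); rewrite ?K' // -(sympl_iso_jj _ iso) K'.
Qed.

(** In the closedness identity the two brackets containing the central [Z] vanish, which leaves this
    single term. *)
Lemma om_br_jj g (X Y Z : g) : Z \in jj g -> om (br X Y) Z = 0.
Proof.
rewrite memv_cap => /andP[/centerP Zc _]; have := om_closed X Y Z.
by rewrite (brC Y Z) !Zc oppr0 !linear0 !zero_lfunE !addr0.
Qed.

Lemma br_jj g (X Y : g) : X \in jj g -> br X Y = 0.
Proof. by rewrite memv_cap => /andP[/centerP]. Qed.

Lemma jj_sub_perp g (X : g) : X \in jj g -> X \in perp (jj g).
Proof.
rewrite memv_cap => /andP[_ /perpP H]; apply/perpP => Y.
by rewrite memv_cap => /andP[/H].
Qed.

End Isomorphisms.

(** * Frames *)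

Lemma block_split (U V W X : zmodType) (f : {additive (U * V * W)%type -> X}) x :
  f x = f (x.1.1, 0, 0) + f (0, x.1.2, 0) + f (0, 0, x.2).
Proof.
case: x => [[z u] w] /=; rewrite -!raddfD; congr (f _).
apply: injective_projections => /=; last by rewrite !add0r.
by apply: injective_projections; rewrite /= ?addr0 ?add0r.
Qed.

Lemma ext_om_brE (R : realType) (l : vectType R) (a : symplLie R)
    (t : triple l a) (X Y W : ext_space l a) :
  ext_om l a (ext_br t X Y) W =
    (beta t X.1.2 Y.1.2 W.2 + gam t X.2 Y.1.2 W.2 - gam t Y.2 X.1.2 W.2
      + eps t X.2 Y.2 W.2)
    + (om (br X.1.2 Y.1.2) W.1.2 + om (xi t X.2 Y.1.2) W.1.2
      - om (xi t Y.2 X.1.2) W.1.2 + om (alpha t X.2 Y.2) W.1.2).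
Proof.
have ev4 (V : vectType R) (x y z w : 'Hom(V, R^o)) v :
    (x + y - z + w) v = x v + y v - z v + w v.
  by rewrite !(add_lfunE, opp_lfunE).
have hom4 (x y z w : a) : om (x + y - z + w) = om x + om y - om z + om w.
  by rewrite !linearD linearN.
by rewrite ext_omE ext_brE /= linear0 subr0 hom4 !ev4.
Qed.

Section Frames.
Variables (R : realType) (l : vectType R) (a g : symplLie R) (t : triple l a).
Local Notation E := (ext_space l a).

(** The source is the bare space [ext_space], since [t] is not yet known to be a cocycle. No field
    treats the blocks [(a, a, l)] and [(l, l, a)]: closedness in [g] reduces them to [frame_xi] and
    [frame_gam], just as [beta] and [alpha] are built from [xi] and [gam]. *)
Record frame (Phi : 'Hom(E, g)) : Prop := Frame {
  frame_om : forall X Y, om (Phi X) (Phi Y) = ext_om l a X Y;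
  frame_surj : limg Phi = fullv;
  frame_central : forall Z Y, br (Phi (Z, 0, 0)) Y = 0;
  frame_br : forall A B C, om (br (Phi (0, A, 0)) (Phi (0, B, 0))) (Phi (0, C, 0))
                         = om (br A B) C;
  frame_xi : forall L A B, om (br (Phi (0, 0, L)) (Phi (0, A, 0))) (Phi (0, B, 0))
                         = om (xi t L A) B;
  frame_gam : forall L A M, om (br (Phi (0, 0, L)) (Phi (0, A, 0))) (Phi (0, 0, M))
                          = gam t L A M;
  frame_eps : forall L M N, om (br (Phi (0, 0, L)) (Phi (0, 0, M))) (Phi (0, 0, N))
                          = eps t L M N }.

Variable Phi : 'Hom(E, g).
Hypothesis fr : frame Phi.

Let cl (X Y Z : g) : om (br X Y) Z = om (br X Z) Y - om (br Y Z) X.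
Proof.
have := om_closed X Y Z; rewrite (brC Z X) linearN opp_lfunE; lra.
Qed.

Let T (X Y W : E) := om (br (Phi X) (Phi Y)) (Phi W).

Let TC X Y W : T X Y W = - T Y X W.
Proof. by rewrite /T brC linearN opp_lfunE. Qed.

Let T0 X Y Z : T X Y (Z, 0, 0) = 0.
Proof.
rewrite /T cl (brC _ (Phi (Z, 0, 0))) (brC (Phi Y)) !(frame_central fr).
by rewrite !oppr0 linear0 !zero_lfunE subr0.
Qed.

Let TE X Y W : T X Y W = ext_om l a (ext_br t X Y) W.
Proof.
(* Every block with an argument in [l^*] vanishes: by centrality in the first two slots, by [T0] in
   the third. Eight blocks remain. *)
have -> : T X Y W =
    T (0, X.1.2, 0) (0, Y.1.2, 0) (0, W.1.2, 0)
  + T (0, X.1.2, 0) (0, Y.1.2, 0) (0, 0, W.2)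
  + T (0, 0, X.2) (0, Y.1.2, 0) (0, W.1.2, 0)
  + T (0, 0, X.2) (0, Y.1.2, 0) (0, 0, W.2)
  - T (0, 0, Y.2) (0, X.1.2, 0) (0, W.1.2, 0)
  - T (0, 0, Y.2) (0, X.1.2, 0) (0, 0, W.2)
  + T (0, 0, X.2) (0, 0, Y.2) (0, W.1.2, 0)
  + T (0, 0, X.2) (0, 0, Y.2) (0, 0, W.2).
  rewrite -!(TC (0, X.1.2, 0)) {1}/T (block_split Phi X) (block_split Phi Y).
  rewrite (block_split Phi W).
  have cent' U Z : br U (Phi (Z, 0, 0)) = 0 by rewrite brC frame_central ?oppr0.
  have om0 U V Z : om (br (Phi U) (Phi V)) (Phi (Z, 0, 0)) = 0 by exact: T0.
  rewrite !linearD /= !add_lfunE !cent' !(frame_central fr).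
  have om_0 (V : g) : om 0 V = 0 by rewrite linear0 zero_lfunE.
  rewrite !add0r !om_0 !linearD /= !add_lfunE !om0 /T; lra.
(* [cl] moves the [l]-argument into the bracket, giving two [xi] blocks whose combination defines
   [beta]; the next block yields [alpha] from two [gam] blocks in the same way. *)
have aal : T (0, X.1.2, 0) (0, Y.1.2, 0) (0, 0, W.2) = beta t X.1.2 Y.1.2 W.2.
  rewrite /T cl (brC _ (Phi (0, 0, W.2))) (brC (Phi (0, Y.1.2, 0))).
  rewrite !linearN !opp_lfunE !(frame_xi fr) betaE (om_skew X.1.2); lra.
have lla : T (0, 0, X.2) (0, 0, Y.2) (0, W.1.2, 0) = om (alpha t X.2 Y.2) W.1.2.
  by rewrite /T cl !(frame_gam fr) alphaE.
rewrite aal lla /T (frame_br fr) !(frame_xi fr) !(frame_gam fr) (frame_eps fr).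
rewrite ext_om_brE; lra.
Qed.

(** By surjectivity both sides need only be paired with vectors [Phi W], where the two trilinear
    forms agree by [TE]. *)
Lemma frame_morph X Y : Phi (ext_br t X Y) = br (Phi X) (Phi Y).
Proof.
apply: om_inj => V; have : V \in limg Phi by rewrite (frame_surj fr) memvf.
by case/memv_imgP => W _ ->; rewrite (frame_om fr) -TE.
Qed.

Let inj X : Phi X = 0 -> X = 0.
Proof.
move=> H; apply: ext_om_nondeg => Y.
by rewrite -(frame_om fr) H linear0 zero_lfunE.
Qed.

Let inl (L : l) : E := (0, 0, L).
Let ina (A : a) : E := (0, A, 0).

(** The identities of [g] pull back along the injective morphism [Phi], before the extension is
    known to be a Lie algebra. The cocycle conditions are their components on pure arguments from
    [a] and [l]. *)
Lemma frame_Z2 : Z2 t.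
Proof.
have ebxx X : ext_br t X X = 0 by apply: inj; rewrite frame_morph brxx.
have ejac X Y Z : ext_br t X (ext_br t Y Z) + ext_br t Y (ext_br t Z X)
    + ext_br t Z (ext_br t X Y) = 0.
  by apply: inj; rewrite !linearD /= !frame_morph jacobi.
have ecl X Y Z : ext_om l a (ext_br t X Y) Z + ext_om l a (ext_br t Y Z) X
    + ext_om l a (ext_br t Z X) Y = 0.
  by rewrite -!(frame_om fr) !frame_morph om_closed.
pose simp0 := (linear0, zero_lfunE, add0r, addr0, sub0r, subr0).
(* The Jacobi identity on [(l, a, a)], [(l, l, a)] and [(l, l, l)] gives each time one condition on
   [xi] from the [a]-component and one on [gam] from the [l^*]-component. *)
have laa L A1 A2 := ejac (inl L) (ina A1) (ina A2).
have lla L1 L2 A := ejac (inl L1) (inl L2) (ina A).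
have lll L1 L2 L3 := ejac (inl L1) (inl L2) (inl L3).
have E1 (X Y : E) : X = Y -> X.1.1 = Y.1.1 by move=> ->.
have E2 (X Y : E) : X = Y -> X.1.2 = Y.1.2 by move=> ->.
split.
- by move=> L; have /E1 := ebxx (inl L); rewrite ext_brE /= !simp0.
- move=> L A1 A2; have /E2 := laa L A1 A2.
  rewrite !ext_brE /= !simp0 !linearN /= (brC A2) => /eqP.
  by rewrite addrAC subr_eq0 subr_eq addrC => /eqP.
- move=> L1 L2 A; have /E2 := lla L1 L2 A.
  by rewrite !ext_brE /= !simp0 !linearN /= (brC A) => /eqP; rewrite subr_eq0 => /eqP.
- by move=> L1 L2 L3; have /E2 := lll L1 L2 L3; rewrite !ext_brE /= !simp0.
- move=> L A1 A2; have /E1 := laa L A1 A2.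
  rewrite !ext_brE /= !simp0 !linearN /= (betaC _ A2) => /eqP.
  by rewrite addrAC subr_eq0 subr_eq addrC eq_sym => /eqP.
- move=> L1 L2 A; have /E1 := lla L1 L2 A.
  rewrite !ext_brE /= !simp0 !linearN /= (betaC _ A) => /eqP.
  by rewrite -oppr_eq0 !opprD !opprK (addrC (- _)) => /eqP.
- by move=> L1 L2 L3; have /E1 := lll L1 L2 L3; rewrite !ext_brE /= !simp0.
- move=> L1 L2 L3; have := ecl (inl L1) (inl L2) (inl L3).
  by rewrite !ext_omE !ext_brE /= !simp0.
Qed.

Lemma frame_sympl_iso (Zt : Z2 t) : @sympl_iso R (extension Zt) g Phi.
Proof.
apply: sympl_iso_surj; [exact: frame_surj | exact: frame_morph | exact: frame_om].
Qed.

End Frames.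

(** * The ideal [j] of an extension *)

Section SharpExtension.
Variables (R : realType) (l : vectType R) (a : symplLie R) (t : triple l a).
Hypothesis Zt : Z2 t.
Local Notation E := (ext_space l a).
Local Notation g := (extension Zt).

Let eqE (X Y : E) : X.1.1 = Y.1.1 -> X.1.2 = Y.1.2 -> X.2 = Y.2 -> X = Y.
Proof. by case: X Y => [[? ?] ?] [[? ?] ?] /= -> -> ->. Qed.

Let perp_extP (W : {vspace g}) (X : E) :
  reflect (forall Y : E, Y \in W -> ext_om l a X Y = 0) (X \in perp W).
Proof. exact: (@perpP R g W X). Qed.

(** As [l^*] is central, only brackets with [a] and with [l] matter; their [l^*]- and [a]-components
    give the system of condition (a), and the [l^*]-component of [X] stays free. *)
Lemma center_extensionP (X : E) : (X \in center g) <->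
  [/\ forall B, br X.1.2 B + xi t X.2 B = 0,
      forall B, gam t X.2 B + beta t X.1.2 B = 0,
      forall M, alpha t X.2 M = xi t M X.1.2
    & forall M, eps t X.2 M = gam t M X.1.2].
Proof.
split=> [/centerP H|[Hbr Hbe Hal Hep]].
  have {}H Y : ext_br t X Y = 0 by exact: H.
  have H1 B : beta t X.1.2 B + gam t X.2 B = 0 /\ br X.1.2 B + xi t X.2 B = 0.
    have := H (0, B, 0); rewrite ext_brE /= !linear0 !zero_lfunE !subr0 !addr0.
    by case.
  have H2 M : eps t X.2 M - gam t M X.1.2 = 0 /\ alpha t X.2 M - xi t M X.1.2 = 0.
    have := H (0, 0, M); rewrite ext_brE /= !linear0 !add0r.
    by rewrite addrC (addrC _ (alpha _ _ _)); case.
  split=> [B|B|M|M]; first by case: (H1 B).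
  - by rewrite addrC; case: (H1 B).
  - by apply/eqP; rewrite -subr_eq0; apply/eqP; case: (H2 M).
  - by apply/eqP; rewrite -subr_eq0; apply/eqP; case: (H2 M).
apply/centerP => Y; rewrite -[LHS]/(ext_br t X Y) ext_brE.
apply: eqE => //=.
  by rewrite (addrC (beta _ _ _)) Hbe Hep sub0r addNr.
by rewrite Hbr Hal sub0r addNr.
Qed.

(** Condition (a) puts the center inside [l^* + a], so it equals [l^* + N] with [N] the subspace of
    condition (b), and its radical is [l^*] plus the radical of [N]. Conversely, if the radical is
    [l^*], a central vector is orthogonal to [l^*] and has no [l]-component, and the radical of [N]
    lies in [j], hence vanishes. *)
Lemma Z2sharpP : Z2sharp t <->
  forall X : E, (X \in jj g) = (X.1.2 == 0) && (X.2 == 0).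
Proof.
have center0 : Z2sharp_a t -> forall X : E, X \in center g -> X.2 = 0.
  by move=> Za X /center_extensionP cX; apply: Za; exists X.1.2; case: cX.
have N_center A : [/\ A \in center a, forall A', beta t A A' = 0,
    forall L, xi t L A = 0 & forall L, gam t L A = 0] <->
    ((0, A, 0) : E) \in center g.
  rewrite center_extensionP /=; split.
    case=> /centerP cA bA xA gA; split=> *.
    - by rewrite cA linear0 zero_lfunE addr0.
    - by rewrite bA linear0 zero_lfunE addr0.
    - by rewrite linear0 zero_lfunE xA.
    - by rewrite linear0 zero_lfunE gA.
  case=> cA bA xA gA; split=> [|B|M|M].
  - by apply/centerP => B; rewrite -(cA B) linear0 zero_lfunE addr0.
  - by rewrite -(bA B) linear0 zero_lfunE add0r.
  - by rewrite -xA linear0 zero_lfunE.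
  - by rewrite -gA linear0 zero_lfunE.
have center_l (Z : 'Hom(l, R^o)) : ((Z, 0, 0) : E) \in center g.
  apply/center_extensionP; by split=> * /=; rewrite !linear0 ?zero_lfunE ?addr0.
have center_a (X : E) : X \in center g -> X.2 = 0 -> ((0, X.1.2, 0) : E) \in center g.
  move=> Xc X2; suff -> : (0, X.1.2, 0) = (X - (X.1.1, 0, 0) : E).
    by rewrite rpredB.
  by apply: eqE; rewrite /= ?subrr ?subr0.
split=> [[_ Za Zb] X|H].
  rewrite memv_cap; apply/andP/andP => [[Xc /perp_extP Xp]|[/eqP X2 /eqP X3]].
    have X2 := center0 Za X Xc; split; last by rewrite X2.
    apply/eqP/Zb => [|B]; first by apply/N_center/center_a.
    move=> /N_center /Xp; rewrite ext_omE /=.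
    by rewrite linear0 zero_lfunE add0r subr0.
  have -> : X = (X.1.1, 0, 0) by apply: eqE.
  split; first exact: center_l.
  apply/perp_extP => Y /(center0 Za) Y2.
  by rewrite ext_omE /= Y2 !linear0 zero_lfunE !addr0.
have Za : Z2sharp_a t.
  move=> L [A [H1 H2 H3 H4]]; apply: dual_eq0 => Z.
  have : ((0, A, L) : E) \in center g by apply/center_extensionP.
  have : ((Z, 0, 0) : E) \in jj g by rewrite H /= !eqxx.
  rewrite memv_cap => /andP[_ /perp_extP Zp] /Zp; rewrite ext_omE /=.
  by rewrite linear0 !zero_lfunE addr0 subr0.
split=> // N A NA Aperp.
have : ((0, A, 0) : E) \in jj g.
  rewrite memv_cap; apply/andP; split; first exact/N_center.
  apply/perp_extP => Y Yc; rewrite ext_omE /= linear0 zero_lfunE add0r subr0.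
  by apply: Aperp; apply/N_center/center_a => //; exact: center0.
by rewrite H /= => /andP[/eqP].
Qed.

Hypothesis St : Z2sharp t.

Lemma jj_extensionE (X : E) : (X \in jj g) = (X.1.2 == 0) && (X.2 == 0).
Proof. exact: (Z2sharpP.1 St). Qed.

Lemma dim_jj_extension : \dim (jj g) = \dim {:l}.
Proof.
pose f : 'Hom('Hom(l, R^o), g) := linfun (fun Z => (Z, 0, 0) : E).
have fE Z : f Z = (Z, 0, 0) by rewrite linfunE //; lin.
have -> : jj g = limg f.
  apply/vspaceP => X; rewrite jj_extensionE.
  apply/andP/memv_imgP => [[/eqP X2 /eqP X3]|[Z _ ->]]; last by rewrite fE /= !eqxx.
  by exists X.1.1; rewrite ?memvf // fE; apply: eqE.
rewrite limg_dim_eq; first by rewrite !dimvf /dim /= muln1.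
apply/vspaceP => Z; rewrite memv_cap memvf memv_ker fE memv0.
by apply/eqP/eqP => [[] | ->].
Qed.

Lemma dim_extension : \dim {:g} = (\dim {:l} + \dim {:a} + \dim {:l})%N.
Proof. by rewrite !dimvf -[LHS]/(dim l * 1 + dim a + dim l)%N muln1. Qed.

(** Here [j] is [l^*] and its orthogonal is [l^* + a], so sending [A] to the class of [(0, A, 0)]
    identifies [a] with the quotient. *)
Lemma reduction_extension : isomorphic (reduction g) a.
Proof.
apply: isomorphic_sym.
have inj_perp A : ((0, A, 0) : E) \in perp (jj g).
  apply/perp_extP => Y; rewrite jj_extensionE => /andP[/eqP Y2 /eqP Y3].
  rewrite ext_omE /= Y2 Y3.
  by rewrite !linear0 !addr0.
pose W := perp (jj g).
pose f := fun A : a => qpi (jj_in_perp g) (vsproj W ((0, A, 0) : E)).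
have fl : linear f.
  move=> k A B; rewrite /f -linearP -linearP; congr (qpi _ (vsproj _ _)).
  by apply: eqE; rewrite /= ?scaler0 ?addr0.
pose phi : 'Hom(a, reduction g) := linfun f.
have phiE A : phi A = f A by rewrite linfunE.
exists phi; apply: sympl_iso_surj => [|A B|A B].
- apply/vspaceP => q; rewrite memvf; apply/memv_imgP.
  rewrite -(qreprK q); move: (qrepr q) => x.
  have xp := subvsP x; pose X : E := vsval x.
  (* Orthogonality to [l^*] kills the [l]-component, so [X] and [(0, X.1.2, 0)] differ by an element
     of [j]. *)
  have X2 : X.2 = 0.
    apply: dual_eq0 => Z; have /perp_extP /(_ (Z, 0, 0)) := xp.
    rewrite jj_extensionE /= !eqxx => /(_ isT).
    rewrite ext_omE /= !linear0 add0r.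
    by move/eqP; rewrite sub0r oppr_eq0 => /eqP.
  exists X.1.2; rewrite ?memvf // phiE; apply/qpiP.
  rewrite mem_jj_in_perp linearB /= vsprojK // jj_extensionE /=.
  by rewrite -/X X2 !subrr !eqxx.
- rewrite !phiE -[RHS]/(red_br _ _ _) red_brE; apply/qpiP.
  rewrite mem_jj_in_perp linearB /= !vsprojK //; last exact: (@br_in_perp _ g).
  rewrite -[br (s := g) _ _]/(ext_br t (0, A, 0) (0, B, 0)) ext_brE /=.
  rewrite jj_extensionE /= !linear0 !zero_lfunE !subr0 !addr0.
  by rewrite subrr !eqxx.
- rewrite -[LHS]/(red_om g (phi A) (phi B)) !phiE red_omE !vsprojK //.
  by rewrite -[LHS]/(ext_om l a _ _) ext_omE /= !zero_lfunE add0r subr0.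
Qed.

End SharpExtension.

(** * The actions of cochains and of [G] *)

Section ActionLaws.
Variables (R : realType) (l : vectType R) (a : symplLie R).
Implicit Types (t : triple l a) (tau sg : 'Hom(l, a)) (p q : 'End(l) * 'End(a)).

Lemma betaNl t (A B : a) M : beta t (- A) B M = - beta t A B M.
Proof. by rewrite linearN !opp_lfunE. Qed.

Lemma betaNr t (A B : a) M : beta t A (- B) M = - beta t A B M.
Proof. by rewrite linearN !opp_lfunE. Qed.

Lemma gamNr t L (A : a) M : gam t L (- A) M = - gam t L A M.
Proof. by rewrite linearN !opp_lfunE. Qed.

Lemma xiNr t L (A : a) : xi t L (- A) = - xi t L A.
Proof. by rewrite linearN. Qed.

Definition tripleN :=
  (@brNl R a, @brNr R a, betaNl, betaNr, gamNr, xiNr, @omNl R a, @omNr R a).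

Let omB (A B C : a) : om (A - B) C = om A C - om B C.
Proof. by rewrite linearB add_lfunE opp_lfunE. Qed.

Let omB' (A B C : a) : om A (B - C) = om A B - om A C.
Proof. by rewrite linearB. Qed.

Lemma gam_act_apply t tau L A M : gam (act t tau) L A M =
  gam t L A M + om (tau M) (xi t L A) - om (tau M) (br (tau L) A)
  - beta t (tau L) A M.
Proof. by rewrite gam_actE !(add_lfunE, opp_lfunE) !tstarE. Qed.

Lemma eps_act_apply t tau L M N : eps (act t tau) L M N =
  eps t L M N + om (tau N) (alpha t L M)
  - gam t L (tau M) N + gam t M (tau L) N
  - om (tau N) (xi t L (tau M)) + om (tau N) (xi t M (tau L))
  + om (tau N) (br (tau L) (tau M)) + beta t (tau L) (tau M) N.
Proof.
rewrite eps_actE !(add_lfunE, opp_lfunE) !tstarE linearB opprB addrA.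
by rewrite addrAC.
Qed.

Lemma om_br_cyc (g : symplLie R) (X Y Z : g) :
  om X (br Y Z) = om Y (br X Z) + om Z (br Y X).
Proof.
have := om_closed X Y Z; rewrite !(om_skew (br _ _)) (brC X Y) (brC Z X) !omNr.
lra.
Qed.

(** [xi] changes by [- ad (tau M)], and closedness turns the failure of [ad (tau M)] to be skew for
    the form into a pairing of [tau M] with the bracket. *)
Lemma beta_actE t tau A B M :
  beta (act t tau) A B M = beta t A B M + om (tau M) (br A B).
Proof.
rewrite !betaE !xi_actE omB omB' (om_br_cyc (tau M) A B).
rewrite (om_skew B) (brC A) omNl; lra.
Qed.

Lemma alpha_actE t tau L M : alpha (act t tau) L M =
  alpha t L M + xi t M (tau L) - xi t L (tau M) + br (tau L) (tau M).
Proof.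
apply: om_inj => A.
have -> (x y z w : a) :
    om (x + y - z + w) A = om x A + om y A - om z A + om w A.
  by rewrite !linearD linearN !(add_lfunE, opp_lfunE).
rewrite !alphaE !gam_act_apply !betaE (om_skew (br (tau L) (tau M))).
rewrite (om_br_cyc A) (brC A) (brC (tau L) A) !omNr; lra.
Qed.

(** The group law of the action. The outer action involves [alpha] and [beta] of the acted triple,
    which the two preceding laws supply; what remains is multilinear expansion. *)
Lemma act_act t tau sg : act (act t tau) sg = act t (tau + sg).
Proof.
have omD (A B C : a) : om (A + B) C = om A C + om B C.
  by rewrite linearD add_lfunE.
have brD (A B C : a) : br (A + B) C = br A C + br B C.
  by rewrite linearD add_lfunE.
have betaD (A B C : a) M : beta t (A + B) C M = beta t A C M + beta t B C M.
  by rewrite linearD !add_lfunE.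
have betaD' (A B C : a) M : beta t C (A + B) M = beta t C A M + beta t C B M.
  by rewrite linearD !add_lfunE.
have gamD L (A B : a) M : gam t L (A + B) M = gam t L A M + gam t L B M.
  by rewrite linearD !add_lfunE.
apply: triple_eq => [L A M|L M N|L A].
- rewrite !gam_act_apply xi_actE beta_actE !add_lfunE !omD !brD !betaD.
  rewrite !linearD linearN /=; lra.
- rewrite !eps_act_apply alpha_actE !gam_act_apply !xi_actE beta_actE !add_lfunE.
  have omD' (A B C : a) : om C (A + B) = om C A + om C B by rewrite linearD.
  have brD' (A B C : a) : br C (A + B) = br C A + br C B by rewrite linearD.
  have xiD K (A B : a) : xi t K (A + B) = xi t K A + xi t K B by rewrite linearD.
  rewrite !omD !brD !brD' !betaD !betaD' !gamD !xiD !omD' !omNr.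
  (* The mixed terms led by [tau M] come from [gam] of the acted triple; reversing them matches the
     order on the other side. *)
  by rewrite (brC (tau M)) (betaC t (tau M)) opp_lfunE !omNr; lra.
- by rewrite !xi_actE add_lfunE brD opprD addrA.
Qed.

Lemma act0 t : act t 0 = t.
Proof.
have br0 (A : a) : br 0 A = 0 by rewrite linear0 zero_lfunE.
have om0 (A : a) : om 0 A = 0 by rewrite linear0 zero_lfunE.
have beta0 (A : a) M : beta t 0 A M = 0 by rewrite linear0 !zero_lfunE.
apply: triple_eq => [L A M|L M N|L A].
- by rewrite gam_act_apply !zero_lfunE !om0 beta0 !(subr0, addr0).
- rewrite eps_act_apply !zero_lfunE !om0 beta0 !linear0 !zero_lfunE.
  by rewrite !(subr0, addr0).
- by rewrite xi_actE zero_lfunE br0 subr0.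
Qed.

Lemma cohom_class_act t tau : cohom_class (act t tau) = cohom_class t.
Proof.
apply/seteqP; split=> [_ [sg _ <-]|_ [sg _ <-]].
  by exists (tau + sg); rewrite ?act_act.
by exists (sg - tau); rewrite // act_act addrC subrK.
Qed.

Lemma mem_cohom_class t : cohom_class t t.
Proof. by exists 0 => //; exact: act0. Qed.

Lemma Ggroup_lker0 p : Ggroup p -> lker p.1 == 0%VS /\ lker p.2 == 0%VS.
Proof. by case=> /bij_inj Si [/bij_inj Ui _ _]; split; apply/lker0P. Qed.

Lemma inv_lfun_inv (V : vectType R) (f : 'End(V)) :
  lker f == 0%VS -> (f^-1^-1)%VF = f.
Proof.
move=> f0; have f'0 : lker (f^-1)%VF == 0%VS.
  by apply/lker0P; exact: can_inj (lker0_lfunVK f0).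
by apply/lfunP => x; rewrite -{1}[x](lker0_lfunK f0 x); exact: lker0_lfunK.
Qed.

(** The product for which [pull] is a right action: [S] enters by precomposition and [U] by
    conjugation, so the components compose in opposite orders. *)
Definition Gmul p q : 'End(l) * 'End(a) := (p.1 \o q.1, q.2 \o p.2)%VF.

Definition Ginv p : 'End(l) * 'End(a) := (p.1^-1, p.2^-1)%VF.

Lemma Ggroup_mul p q : Ggroup p -> Ggroup q -> Ggroup (Gmul p q).
Proof.
case: p q => [S U] [S' U'] [/= Sb [Ub Ubr Uom]] [/= S'b [U'b U'br U'om]].
split; first by apply: (eq_bij (bij_comp Sb S'b)) => x; rewrite comp_lfunE.
split=> [|X Y|X Y]; rewrite /= ?comp_lfunE ?Ubr ?U'br ?U'om ?Uom //.
by apply: (eq_bij (bij_comp U'b Ub)) => x; rewrite comp_lfunE.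
Qed.

Lemma Ggroup_inv p : Ggroup p -> Ggroup (Ginv p).
Proof.
move=> Gp; have [S0 U0] := Ggroup_lker0 Gp; case: Gp => _ [_ Ubr Uom].
split=> /=; first by exists p.1; [exact: lker0_lfunVK | exact: lker0_lfunK].
split=> [|X Y|X Y].
- by exists p.2; [exact: lker0_lfunVK | exact: lker0_lfunK].
- by apply: (can_inj (lker0_lfunK U0)); rewrite Ubr !lker0_lfunVK.
- by rewrite -Uom !lker0_lfunVK.
Qed.

Definition Gone : 'End(l) * 'End(a) := (\1%VF, \1%VF).

Lemma Ggroup_one : Ggroup Gone.
Proof.
split; last split=> [|X Y|X Y]; rewrite /= ?id_lfunE //.
  by exists id => x; rewrite id_lfunE.
by exists id => x; rewrite id_lfunE.
Qed.

Lemma pull_pull p q t : Ggroup p -> Ggroup q ->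
  pull q (pull p t) = pull (Gmul p q) t.
Proof.
move=> Gp Gq; have [_ V0] := Ggroup_lker0 (Ggroup_mul Gp Gq).
have [_ U0] := Ggroup_lker0 Gp; have [_ U'0] := Ggroup_lker0 Gq.
have VE A : (p.2^-1)%VF ((q.2^-1)%VF A) = ((Gmul p q).2^-1)%VF A.
  apply: (can_inj (lker0_lfunK V0)).
  by rewrite (lker0_lfunVK V0) comp_lfunE !lker0_lfunVK.
apply: triple_eq => [L A M|L M N|L A].
- by rewrite !gam_pullE VE !comp_lfunE.
- by rewrite !eps_pullE !comp_lfunE.
- by rewrite !xi_pullE VE !comp_lfunE.
Qed.

Lemma pull_id t : pull Gone t = t.
Proof.
have [_ U0] := Ggroup_lker0 Ggroup_one.
have VE A : (Gone.2^-1)%VF A = A by rewrite -[RHS](lker0_lfunVK U0) id_lfunE.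
apply: triple_eq => [L A M|L M N|L A].
- by rewrite gam_pullE VE !id_lfunE.
- by rewrite eps_pullE !id_lfunE.
- by rewrite xi_pullE VE !id_lfunE.
Qed.

Lemma GmulKV p q : Ggroup p -> Gmul p (Gmul (Ginv p) q) = q.
Proof.
move=> Gp; have [S0 U0] := Ggroup_lker0 Gp.
rewrite [RHS]surjective_pairing; apply: injective_projections.
  by apply/lfunP => x; rewrite !comp_lfunE lker0_lfunVK.
by apply/lfunP => x; rewrite !comp_lfunE /= lker0_lfunK.
Qed.

Lemma Gorbit_pull p t : Ggroup p ->
  Gorbit (cohom_class (pull p t)) = Gorbit (cohom_class t).
Proof.
move=> Gp; apply/seteqP; split=> [_ [q Gq <-]|_ [q Gq <-]].
  have Gpq := Ggroup_mul Gp Gq; exists (Gmul p q) => //.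
  by rewrite (pullH_class Gq) (pullH_class Gpq) (pull_pull t Gp Gq).
have Gpq := Ggroup_mul (Ggroup_inv Gp) Gq; exists (Gmul (Ginv p) q) => //.
rewrite (pullH_class Gpq) (pull_pull t Gp Gpq) (GmulKV q Gp).
by rewrite (pullH_class Gq).
Qed.

(** Orbits are sets of sets of triples. Descending to elements uses that the class of [t1] belongs
    to its orbit (unit of [G]) and [t1] to its class (zero cochain). *)
Lemma Gorbit_eqP t1 t2 :
  Gorbit (cohom_class t1) = Gorbit (cohom_class t2) <->
  exists p tau, Ggroup p /\ t1 = pull p (act t2 tau).
Proof.
split=> [e|[p [tau [Gp ->]]]]; last by rewrite Gorbit_pull ?cohom_class_act.
have : Gorbit (cohom_class t1) (cohom_class t1).
  exists Gone; first exact: Ggroup_one.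
  by rewrite (pullH_class Ggroup_one) pull_id.
rewrite e => -[p Gp e1]; have := mem_cohom_class t1; rewrite -e1.
by case=> _ [tau _ <-] <-; exists p, tau.
Qed.

End ActionLaws.

(** * Isomorphisms of extensions *)

Section EquivalentTriples.
Variables (R : realType) (l : vectType R) (a : symplLie R).
Variables (t : triple l a) (tau : 'Hom(l, a)) (p : 'End(l) * 'End(a)).
Hypotheses (Zt : Z2 t) (Gp : Ggroup p).
Local Notation E := (ext_space l a).
Local Notation S := p.1.
Local Notation V := (p.2^-1)%VF.

(* The complement [L |-> S L - tau (S L)] to [l^* + a] is made isotropic by the
   correction [tstar tau (tau (S L)) / 2], and the correction [- tstar tau] makes
   [a] orthogonal to it. *)
Definition pull_act_map : 'Hom(E, E) := linfun (fun X : E =>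
  (((X.1.1 \o S^-1)%VF - tstar tau (V X.1.2)
      + tstar (2^-1 *: tau) (tau (S X.2)),
    V X.1.2 - tau (S X.2)), S X.2)).

Lemma pull_act_mapE X : pull_act_map X =
  (((X.1.1 \o S^-1)%VF - tstar tau (V X.1.2)
      + tstar (2^-1 *: tau) (tau (S X.2)),
    V X.1.2 - tau (S X.2)), S X.2).
Proof. by rewrite /pull_act_map linfunE //; lin. Qed.

(** The formulas defining [act] and [pull] are exactly the restricted trilinear forms of the
    extension by [t], read through [pull_act_map]. *)
Lemma frame_pull_act : frame (g := extension Zt) (pull p (act t tau)) pull_act_map.
Proof.
have [S0 U0] := Ggroup_lker0 Gp.
have omV A B : om (V A) (V B) = om A B.
  by case: Gp => _ [_ _ H]; rewrite -H !lker0_lfunVK.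
have brV A B : br (V A) (V B) = V (br A B).
  apply: (can_inj (lker0_lfunK U0)).
  by case: Gp => _ [_ -> _]; rewrite !lker0_lfunVK.
have Phi_om X Y : ext_om l a (pull_act_map X) (pull_act_map Y) = ext_om l a X Y.
  rewrite !pull_act_mapE !ext_omE /= !(add_lfunE, opp_lfunE) !comp_lfunE !tstarE.
  rewrite !(lker0_lfunK S0) !scale_lfunE.
  have omZ (A B : a) : om (2^-1 *: A) B = 2^-1 * om A B.
    by rewrite linearZ scale_lfunE.
  rewrite !omZ !linearB /= !(add_lfunE, opp_lfunE) omV.
  rewrite (om_skew (tau (S Y.2)) (V _)) (om_skew (tau (S Y.2)) (tau _)); lra.
have PhiZ Z : pull_act_map (Z, 0, 0) = ((Z \o S^-1)%VF, 0, 0).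
  by rewrite pull_act_mapE /= !linear0 !(addr0, subr0).
have PhiA A : pull_act_map (0, A, 0) = (- tstar tau (V A), V A, 0).
  by rewrite pull_act_mapE /= comp_lfun0l !linear0 !(addr0, subr0, sub0r).
have PhiL L : pull_act_map (0, 0, L) =
    (tstar (2^-1 *: tau) (tau (S L)), - tau (S L), S L).
  by rewrite pull_act_mapE /= comp_lfun0l !linear0 !(subr0, sub0r, add0r).
pose simp0 := (linear0, zero_lfunE, addr0, add0r, subr0, sub0r).
split.
- exact: Phi_om.
(* A form-preserving endomorphism is injective, hence onto in finite dimension. *)
- apply/lker0_limgf/eqP/vspaceP => X; rewrite memv_ker memv0.
  apply/eqP/eqP => [H|->]; last by rewrite linear0.
  by apply: ext_om_nondeg => Y; rewrite -Phi_om H linear0 zero_lfunE.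
- move=> Z Y; rewrite -[LHS]/(ext_br t _ _) ext_brE PhiZ /=.
  by rewrite !simp0.
- move=> A B C; rewrite -[LHS]/(ext_om l a (ext_br t _ _) _) ext_om_brE.
  by rewrite !PhiA /= !simp0 brV omV.
- move=> L A B; rewrite -[LHS]/(ext_om l a (ext_br t _ _) _) ext_om_brE.
  rewrite xi_pullE xi_actE !PhiA !PhiL /= !simp0 !tripleN.
  have omU A1 B1 : om (p.2 A1) B1 = om A1 (V B1).
    by rewrite -[in RHS](lker0_lfunK U0 A1) omV.
  by rewrite omU linearB add_lfunE opp_lfunE /= addrC.
- move=> L A M; rewrite -[LHS]/(ext_om l a (ext_br t _ _) _) ext_om_brE.
  rewrite gam_pullE gam_act_apply !PhiA !PhiL /= !simp0 !tripleN.
  rewrite !(om_skew (tau (S M))); lra.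
- move=> L M N; rewrite -[LHS]/(ext_om l a (ext_br t _ _) _) ext_om_brE.
  rewrite eps_pullE eps_act_apply !PhiL /= !tripleN.
  rewrite !(om_skew (tau (S N))); lra.
Qed.
End EquivalentTriples.

(** * Block decomposition of an isomorphism between sharp extensions *)

Section IsomorphicExtensions.
Variables (R : realType) (l1 l2 : vectType R) (a1 a2 : symplLie R).
Variables (t1 : triple l1 a1) (t2 : triple l2 a2).
Hypotheses (Z1 : Z2 t1) (Z2t : Z2 t2) (S1 : Z2sharp t1) (S2 : Z2sharp t2).
Local Notation E1 := (ext_space l1 a1).
Local Notation E2 := (ext_space l2 a2).
Variable Phi : 'Hom(E1, E2).
Hypothesis iso : @sympl_iso R (extension Z1) (extension Z2t) Phi.

Let Phi_br X Y : Phi (ext_br t1 X Y) = ext_br t2 (Phi X) (Phi Y).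
Proof. by case: iso => _ H _; exact: H. Qed.

Let Phi_om X Y : ext_om l2 a2 (Phi X) (Phi Y) = ext_om l1 a1 X Y.
Proof. by case: iso => _ _ H; exact: H. Qed.

Let Phi_jj X : ((Phi X).1.2 == 0) && ((Phi X).2 == 0) = (X.1.2 == 0) && (X.2 == 0).
Proof.
rewrite -(jj_extensionE Z2t S2) -(jj_extensionE Z1 S1).
exact: (@sympl_iso_jj R (extension Z1) (extension Z2t) Phi X iso).
Qed.

Let Phi_surj Y : exists X, Phi X = Y.
Proof. by case: iso => -[psi _ K] _ _; exists (psi Y); exact: K. Qed.

Definition iso_l : 'Hom(l1, l2) := linfun (fun L => (Phi (0, 0, L)).2).
Definition iso_a : 'Hom(a1, a2) := linfun (fun A => (Phi (0, A, 0)).1.2).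
Definition iso_la : 'Hom(l1, a2) := linfun (fun L => (Phi (0, 0, L)).1.2).

Let iso_lE L : iso_l L = (Phi (0, 0, L)).2.
Proof. by rewrite linfunE //; lin. Qed.
Let iso_aE A : iso_a A = (Phi (0, A, 0)).1.2.
Proof. by rewrite linfunE //; lin. Qed.
Let iso_laE L : iso_la L = (Phi (0, 0, L)).1.2.
Proof. by rewrite linfunE //; lin. Qed.

Let PhiZ Z : (Phi (Z, 0, 0)).1.2 = 0 /\ (Phi (Z, 0, 0)).2 = 0.
Proof.
have : ((Phi (Z, 0, 0)).1.2 == 0) && ((Phi (Z, 0, 0)).2 == 0).
  by rewrite Phi_jj /= !eqxx.
by case/andP => /eqP -> /eqP ->.
Qed.

(** The preimage of [(Z, 0, 0)] lies in [j] of the source, that is in [l^*], so it is orthogonal to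
    [a]; hence every [Z] kills this [l]-component. *)
Let PhiA A : (Phi (0, A, 0)).2 = 0.
Proof.
apply: dual_eq0 => Z; have [X XE] := Phi_surj (Z, 0, 0).
have : (X.1.2 == 0) && (X.2 == 0) by rewrite -Phi_jj XE /= !eqxx.
case/andP => /eqP X2 /eqP X3.
have := Phi_om X (0, A, 0); rewrite XE !ext_omE /= X2 X3.
by rewrite !linear0 !zero_lfunE !addr0.
Qed.

Let Phi2 X : (Phi X).2 = iso_l X.2.
Proof.
rewrite (block_split Phi X) /= iso_lE PhiA.
by case: (PhiZ X.1.1) => _ ->; rewrite !add0r.
Qed.

Let Phi12 X : (Phi X).1.2 = iso_a X.1.2 + iso_la X.2.
Proof.
rewrite (block_split Phi X) /= iso_aE iso_laE.
by case: (PhiZ X.1.1) => -> _; rewrite !add0r.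
Qed.

(** The form pairs [l^*] with [l] perfectly and [Phi] maps [l^*] into [l^*]: if [Phi (0, 0, L)] has
    no [l]-component, every [Z] vanishes at [L]. *)
Let iso_l_inj : injective iso_l.
Proof.
suff ker0 L : iso_l L = 0 -> L = 0.
  move=> L M LM; apply/eqP; rewrite -subr_eq0; apply/eqP/ker0.
  by rewrite linearB /= LM subrr.
rewrite iso_lE => L0; apply: dual_eq0 => Z.
have := Phi_om (Z, 0, 0) (0, 0, L); rewrite !ext_omE /= L0.
case: (PhiZ Z) => -> ->.
by rewrite !linear0 !zero_lfunE !(addr0, subr0).
Qed.

(** The middle block is the map that [Phi] induces between the quotients of [l^* + a] by [l^*]. *)
Lemma iso_a_sympl : sympl_iso iso_a.
Proof.
apply: sympl_iso_surj => [|A B|A B].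
- apply/vspaceP => B; rewrite memvf; apply/memv_imgP.
  have [X XE] := Phi_surj (0, B, 0).
  have X3 : X.2 = 0 by apply: iso_l_inj; rewrite -Phi2 XE linear0.
  exists X.1.2; rewrite ?memvf //.
  by have := Phi12 X; rewrite XE X3 linear0 addr0.
- have := congr1 (fun X => X.1.2) (Phi_br (0, A, 0) (0, B, 0)).
  rewrite Phi12 !ext_brE /= !PhiA !iso_aE !linear0 !zero_lfunE.
  by rewrite !(subr0, addr0).
- have := Phi_om (0, A, 0) (0, B, 0).
  rewrite !ext_omE /= !PhiA !iso_aE !linear0.
  by rewrite !(subr0, addr0, add0r).
Qed.

Let Phi_om_br X Y W : ext_om l2 a2 (ext_br t2 (Phi X) (Phi Y)) (Phi W) =
  ext_om l1 a1 (ext_br t1 X Y) W.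
Proof. by rewrite -Phi_br Phi_om. Qed.

Lemma iso_xi L A : iso_a (xi t1 L A) =
  br (iso_la L) (iso_a A) + xi t2 (iso_l L) (iso_a A).
Proof.
have := congr1 (fun X => X.1.2) (Phi_br (0, 0, L) (0, A, 0)).
rewrite Phi12 !ext_brE /= !PhiA !iso_aE !iso_laE !iso_lE !linear0 !zero_lfunE.
by rewrite !(subr0, addr0, add0r).
Qed.

(** Comparing trilinear forms instead of [l^*]-components of brackets keeps the blocks of [Phi] with
    values in [l^*] out of the formula. *)
Lemma iso_gam L A M : gam t1 L A M =
  beta t2 (iso_la L) (iso_a A) (iso_l M) + gam t2 (iso_l L) (iso_a A) (iso_l M)
  + om (br (iso_la L) (iso_a A)) (iso_la M)
  + om (xi t2 (iso_l L) (iso_a A)) (iso_la M).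
Proof.
have := Phi_om_br (0, 0, L) (0, A, 0) (0, 0, M).
rewrite !ext_om_brE !Phi12 !Phi2 /=.
by rewrite !(linear0, zero_lfunE, subr0, addr0, add0r) addrA => <-.
Qed.

Lemma iso_eps L M N : eps t1 L M N =
  beta t2 (iso_la L) (iso_la M) (iso_l N) + gam t2 (iso_l L) (iso_la M) (iso_l N)
  - gam t2 (iso_l M) (iso_la L) (iso_l N) + eps t2 (iso_l L) (iso_l M) (iso_l N)
  + om (br (iso_la L) (iso_la M)) (iso_la N)
  + om (xi t2 (iso_l L) (iso_la M)) (iso_la N)
  - om (xi t2 (iso_l M) (iso_la L)) (iso_la N)
  + om (alpha t2 (iso_l L) (iso_l M)) (iso_la N).
Proof.
have := Phi_om_br (0, 0, L) (0, 0, M) (0, 0, N).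
rewrite !ext_om_brE !Phi12 !Phi2 /=.
by rewrite !(linear0, zero_lfunE, subr0, addr0, add0r) !addrA => <-.
Qed.

Lemma iso_l_lker0 : lker iso_l == 0%VS.
Proof. by apply/lker0P; exact: iso_l_inj. Qed.

End IsomorphicExtensions.

Lemma isomorphic_extension_core (R : realType) (l1 l2 : vectType R)
    (a1 a2 : symplLie R) (t1 : triple l1 a1) (t2 : triple l2 a2)
    (Z1 : Z2 t1) (Z2t : Z2 t2) : Z2sharp t1 -> Z2sharp t2 ->
  isomorphic (extension Z1) (extension Z2t) -> isomorphic a1 a2.
Proof.
move=> S1 S2 [Phi iso]; exists (iso_a Phi); exact: iso_a_sympl iso.
Qed.

Section Classification.
Variables (R : realType) (l : vectType R) (a : symplLie R).
Implicit Types t : triple l a.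

Lemma isomorphic_extensionP t1 t2 (Z1 : Z2 t1) (Z2t : Z2 t2) :
  Z2sharp t1 -> Z2sharp t2 ->
  isomorphic (extension Z1) (extension Z2t) <->
  Gorbit (cohom_class t1) = Gorbit (cohom_class t2).
Proof.
move=> S1 S2; rewrite Gorbit_eqP; split=> [[Phi iso]|[p [tau [Gp e]]]]; last first.
  move: Z1 S1; rewrite e => Z1 S1; exists (pull_act_map tau p).
  exact/frame_sympl_iso/frame_pull_act.
have l0 := iso_l_lker0 S1 S2 iso.
have Uiso := iso_a_sympl S1 S2 iso.
have U0 : lker (iso_a Phi) == 0%VS by apply/lker0P; case: Uiso => /bij_inj.
(* The choice matches the blocks of [pull_act_map], where [a] is mapped by the inverse of [p.2] and
   [l] is sent to [a] by [- tau \o p.1]. *)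
pose p : 'End(l) * 'End(a) := (iso_l Phi, (iso_a Phi)^-1%VF).
pose tau : 'Hom(l, a) := (- (iso_la Phi \o (iso_l Phi)^-1))%VF.
have tauE L : tau (iso_l Phi L) = - iso_la Phi L.
  by rewrite opp_lfunE comp_lfunE lker0_lfunK.
have pE : (p.2^-1)%VF = iso_a Phi by exact: inv_lfun_inv.
have Gp : Ggroup p.
  case: Uiso => _ Ubr Uom; split.
    exists ((iso_l Phi)^-1)%VF; [exact: lker0_lfunK | exact: lker0_lfunVK].
  split=> [|X Y|X Y].
  - exists (iso_a Phi); [exact: lker0_lfunVK | exact: lker0_lfunK].
  - by apply: (can_inj (lker0_lfunK U0)); rewrite Ubr !lker0_lfunVK.
  - by rewrite -Uom !lker0_lfunVK.
exists p, tau; split=> //.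
apply: triple_eq => [L A M|L M N|L A].
- rewrite gam_pullE pE gam_act_apply (iso_gam S1 S2 iso) !tauE !tripleN.
  rewrite !(om_skew (iso_la Phi M)); lra.
- rewrite eps_pullE eps_act_apply (iso_eps S1 S2 iso) !tauE !tripleN.
  rewrite !(om_skew (iso_la Phi N)); lra.
- rewrite xi_pullE pE xi_actE tauE brNl opprK addrC -(iso_xi S1 S2 iso).
  by rewrite (lker0_lfunK U0).
Qed.

End Classification.

(** * Every symplectic Lie algebra is an extension of its reduction *)

(** Sends a basis to a basis; rank-nullity gives the trivial kernel. Serves to identify [l^*] with
    [j]. *)
Lemma exists_lfun_img (K : fieldType) (U V : vectType K) (W : {vspace V}) :
  \dim {:U} = \dim W ->
  exists f : 'Hom(U, V), lker f == 0%VS /\ limg f = W.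
Proof.
move=> dimUW; have [f fE] := linear_of_free (vbasis {:U}) (vbasis W).
have img : limg (linfun f) = W.
  rewrite -{1}(span_basis (vbasisP {:U})) limg_span -[RHS](span_basis (vbasisP W)).
  rewrite -fE ?size_tuple ?(basis_free (vbasisP _)) //.
  by congr (<<_>>)%VS; apply: eq_map => x; rewrite lfunE.
exists (linfun f); split=> //; have := limg_ker_dim (linfun f) fullv.
by rewrite img capfv dimUW => /eqP; rewrite -[X in _ == X]add0n eqn_add2r dimv_eq0.
Qed.

Section StructureTriple.
Variables (R : realType) (l : vectType R) (a g : symplLie R).
Variables (iL : 'Hom(l, g)) (iA : 'Hom(a, g)).

(** Reads a triple off the trilinear form of [g]; [sharp] recovers the vector [xi L A] from its
    pairings with [a]. *)
Definition structure_triple : triple l a := {|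
  gam := bilfun (fun L A => linfun (fun M => om (br (iL L) (iA A)) (iL M) : R^o));
  eps := bilfun (fun L M => linfun (fun N => om (br (iL L) (iL M)) (iL N) : R^o));
  xi := bilfun (fun L A =>
    sharp a (linfun (fun B : a => om (br (iL L) (iA A)) (iA B) : R^o))) |}.

Lemma gam_structureE L A M :
  gam structure_triple L A M = om (br (iL L) (iA A)) (iL M).
Proof. by rewrite bilfunE ?linfunE //; lin. Qed.

Lemma eps_structureE L M N :
  eps structure_triple L M N = om (br (iL L) (iL M)) (iL N).
Proof. by rewrite bilfunE ?linfunE //; lin. Qed.

Lemma xi_structureE L A B :
  om (xi structure_triple L A) B = om (br (iL L) (iA A)) (iA B).
Proof. by rewrite bilfunE ?sharpK ?linfunE //; lin. Qed.

End StructureTriple.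

Section ExtensionOfReduction.
Variables (R : realType) (l : vectType R) (a g : symplLie R).
Variables (psi : 'Hom(a, reduction g)) (theta : 'Hom('Hom(l, R^o), g)).
Hypotheses (psi_iso : sympl_iso psi) (theta0 : lker theta == 0%VS).
Hypothesis theta_img : limg theta = jj g.
Local Notation E := (ext_space l a).
Local Notation W := (perp (jj g)).

Let theta_jj Z : theta Z \in jj g.
Proof. by rewrite -theta_img memv_img ?memvf. Qed.

Let jj_theta X : X \in jj g -> exists Z, X = theta Z.
Proof. by rewrite -theta_img => /memv_imgP[Z _ ->]; exists Z. Qed.

Let om_jj_perp X Y : X \in jj g -> Y \in W -> om X Y = 0.
Proof. by move=> Xj /perpP H; rewrite om_skew H ?oppr0. Qed.

Let thetaK Z : (theta^-1)%VF (projv (jj g) (theta Z)) = Z.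
Proof. by rewrite projv_id // lker0_lfunK. Qed.

(** Embeds [l] dually to [theta]: the functional with value [- Z L] at [theta Z] is extended to [g]
    by projecting to [j], then represented through the form. *)
Let iL0 : 'Hom(l, g) := linfun (fun L => sharp g (linfun (fun X : g =>
  - (theta^-1)%VF (projv (jj g) X) L : R^o))).

Let om_L0_theta L Z : om (iL0 L) (theta Z) = - Z L.
Proof. by rewrite linfunE ?sharpK ?linfunE ?thetaK //; lin. Qed.

(* Half of [om (iL0 L) (iL0 M)] is removed through each of its two arguments. *)
Let iLh : 'Hom(l, g) := - 2^-1 *: iL0.

Let muL (L : l) : 'Hom(l, R^o) := linfun (fun M => om (iL0 L) (iLh M) : R^o).

Let muLE L M : muL L M = om (iL0 L) (iLh M).
Proof. by rewrite linfunE //; lin. Qed.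

Let iL : 'Hom(l, g) := linfun (fun L => iL0 L + theta (muL L)).

Let iLE L : iL L = iL0 L + theta (muL L).
Proof. by rewrite linfunE // /muL; lin. Qed.

Let om_theta_L Z L : om (theta Z) (iL L) = Z L.
Proof.
rewrite iLE linearD /= (om_jj_perp (theta_jj Z) (jj_sub_perp (theta_jj _))).
rewrite addr0.
by rewrite om_skew om_L0_theta opprK.
Qed.

Let om_L_L L M : om (iL L) (iL M) = 0.
Proof.
rewrite {1}iLE linearD add_lfunE om_theta_L muLE iLE linearD /= om_L0_theta muLE.
rewrite !scale_lfunE !linearZ /= (om_skew (iL0 M)).
have scaleE (c x : R) : c *: (x : R^o) = c * x by [].
by rewrite !scaleE; lra.
Qed.

(** A linear section of the quotient map; the chosen representatives [qrepr] need not depend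
    linearly on the class. *)
Let sec : 'Hom(quotv (jj_in_perp g), subvs_of W) :=
  ((linfun (qpi (jj_in_perp g)))^-1)%VF.

Let secK q : qpi (jj_in_perp g) (sec q) = q.
Proof.
rewrite -[LHS](lfunE (qpi (jj_in_perp g))) limg_lfunVK //.
by apply/memv_imgP; exists (qrepr q); rewrite ?memvf // lfunE /= qreprK.
Qed.

Let lift : 'Hom(a, subvs_of W) := (sec \o psi)%VF.

Let liftE A : qpi (jj_in_perp g) (lift A) = psi A.
Proof. by rewrite comp_lfunE; exact: secK. Qed.

Let iA0 : 'Hom(a, g) := (linfun (@vsval _ _ W) \o lift)%VF.

Let iA0E A : iA0 A = vsval (lift A).
Proof. by rewrite comp_lfunE lfunE. Qed.

Let muA (A : a) : 'Hom(l, R^o) := linfun (fun L => - om (iA0 A) (iL L) : R^o).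

Let muAE A L : muA A L = - om (iA0 A) (iL L).
Proof. by rewrite linfunE //; lin. Qed.

Let iA : 'Hom(a, g) := linfun (fun A => iA0 A + theta (muA A)).

Let iAE A : iA A = iA0 A + theta (muA A).
Proof. by rewrite linfunE // /muA; lin. Qed.

Let iA0_perp A : iA0 A \in W. Proof. by rewrite iA0E subvsP. Qed.

Let iA_perp A : iA A \in W.
Proof. by rewrite iAE memvD // jj_sub_perp. Qed.

Let om_theta_A Z A : om (theta Z) (iA A) = 0.
Proof. exact: om_jj_perp. Qed.

Let om_A_L A L : om (iA A) (iL L) = 0.
Proof.
by rewrite iAE linearD add_lfunE om_theta_L muAE subrr.
Qed.

(** The corrections by [theta] lie in [j], which is orthogonal to [j^perp], so only the form of the
    reduction remains. *)
Let om_A_A A B : om (iA A) (iA B) = om A B.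
Proof.
rewrite iAE linearD add_lfunE om_theta_A addr0.
rewrite iAE linearD /= (om_skew _ (theta _)) (om_jj_perp (theta_jj _)) //.
case: psi_iso => _ _ <-; rewrite -!liftE oppr0 addr0 -[RHS]/(red_om g _ _) red_omE.
by rewrite !iA0E.
Qed.

Let br_A_A A B C : om (br (iA A) (iA B)) (iA C) = om (br A B) C.
Proof.
have brth Z X : br (theta Z) X = 0 by exact: br_jj.
have -> : br (iA A) (iA B) = br (iA0 A) (iA0 B).
  rewrite !iAE linearD /= (brC _ (theta _)) brth oppr0 addr0.
  by rewrite linearD add_lfunE brth addr0.
rewrite iAE linearD /= (om_br_jj _ _ (theta_jj _)) addr0 !iA0E.
case: psi_iso => _ brpsi <-; rewrite brpsi -!liftE.
rewrite -[RHS]/(red_om g (red_br g _ _) _) red_brE red_omE.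
by rewrite vsprojK ?br_in_perp ?subvsP.
Qed.

Let Phi : 'Hom(E, g) := linfun (fun X : E => theta X.1.1 + iA X.1.2 + iL X.2).

Let PhiE X : Phi X = theta X.1.1 + iA X.1.2 + iL X.2.
Proof. by rewrite linfunE //; lin. Qed.

Let PhiZ Z : Phi (Z, 0, 0) = theta Z.
Proof. by rewrite PhiE !linear0 !addr0. Qed.

Let PhiA A : Phi (0, A, 0) = iA A.
Proof. by rewrite PhiE !linear0 addr0 add0r. Qed.

Let PhiL L : Phi (0, 0, L) = iL L.
Proof. by rewrite PhiE !linear0 !add0r. Qed.

(** Orthogonality to [theta] places [X] in [j^perp], orthogonality to [iA] makes its class in the
    reduction zero, so [X = theta Z], and pairing with [iL] gives [Z = 0]. This yields the
    surjectivity of [Phi] by taking the orthogonal twice. *)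
Let Phi_perp X : (forall Y, om X (Phi Y) = 0) -> X = 0.
Proof.
move=> H.
have XW : X \in W.
  by apply/perpP => _ /jj_theta[Z ->]; rewrite -PhiZ.
have : X \in jj g.
  rewrite -[X]/(vsval (Subvs XW)) -mem_jj_in_perp -[Subvs XW]subr0.
  apply/qpiP; rewrite linear0; apply: red_om_nondeg => q.
  have [_ K'] := sympl_iso_inv psi_iso; rewrite -(K' q) -liftE red_omE -iA0E /=.
  have := H (0, (psi^-1)%VF q, 0); rewrite PhiA iAE linearD /=.
  by rewrite (om_skew _ (theta _)) (om_jj_perp (theta_jj _) XW) oppr0 addr0.
case/jj_theta => Z XE; suff Z0 : Z = 0 by rewrite XE Z0 linear0.
by apply/lfunP => L; rewrite -om_theta_L -XE -PhiL H zero_lfunE.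
Qed.

Lemma frame_reduction : frame (structure_triple iL iA) Phi.
Proof.
split.
- have omDl (U V T : g) : om (U + V) T = om U T + om V T.
    by rewrite linearD add_lfunE.
  have omDr (U V T : g) : om T (U + V) = om T U + om T V by rewrite linearD.
  move=> X Y; rewrite !PhiE ext_omE !omDl !omDr.
  rewrite !om_theta_L !om_L_L !om_A_L !om_A_A !om_theta_A.
  rewrite (om_skew (iA _) (theta _)) (om_skew (iL _) (theta _)).
  rewrite (om_skew (iL _) (iA _)) om_theta_A om_theta_L om_A_L.
  rewrite (om_jj_perp (theta_jj _) (jj_sub_perp (theta_jj _))).
  by rewrite oppr0; lra.
- rewrite -[LHS]perpK; apply/vspaceP => X; rewrite memvf; apply/perpP => Y YP.
  suff Y0 : Y = 0 by rewrite Y0 linear0.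
  by apply: Phi_perp => Z; have /perpP := YP; apply; rewrite memv_img ?memvf.
- by move=> Z Y; rewrite PhiZ br_jj.
- by move=> A B C; rewrite !PhiA br_A_A.
- by move=> L A B; rewrite !PhiL !PhiA xi_structureE.
- by move=> L A M; rewrite !PhiL !PhiA gam_structureE.
- by move=> L M N; rewrite !PhiL eps_structureE.
Qed.

(** Sharpness holds because the isomorphism [Phi] preserves [j] and maps [l^*] onto [j] of [g],
    which is the criterion [Z2sharpP]. *)
Lemma exists_extension_reduction : exists2 t : triple l a,
  Z2sharp t & exists Zt : Z2 t, isomorphic (extension Zt) g.
Proof.
have Zt := frame_Z2 frame_reduction; have iso := frame_sympl_iso frame_reduction Zt.
exists (structure_triple iL iA); last by exists Zt, Phi.
apply/(Z2sharpP Zt) => X.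
transitivity (Phi X \in jj g).
  by symmetry; exact: (@sympl_iso_jj R (extension Zt) g Phi X iso).
apply/idP/andP => [/jj_theta[Z]|[/eqP X2 /eqP X3]].
  rewrite -PhiZ => e; have [K _] := sympl_iso_inv iso.
  by have -> := can_inj K e; rewrite /= !eqxx.
by rewrite PhiE X2 X3 !linear0 !addr0.
Qed.

End ExtensionOfReduction.

(** * The classification *)

Lemma isomorphic_extension_of_reduction (R : realType) (l : vectType R)
    (a g : symplLie R) :
  \dim (jj g) = \dim {:l} -> isomorphic (reduction g) a ->
  exists2 t : triple l a, Z2sharp t & exists Zt : Z2 t, isomorphic (extension Zt) g.
Proof.
move=> dimj /isomorphic_sym[psi psi_iso].
have dim_dual : \dim {: 'Hom(l, R^o)} = \dim (jj g).
  by rewrite dimj !dimvf /dim /= muln1.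
have [theta [theta0 theta_img]] := exists_lfun_img dim_dual.
exact: exists_extension_reduction psi_iso theta0 theta_img.
Qed.

Lemma dim_rV (R : realType) (n : nat) : \dim {: 'rV[R]_n} = n.
Proof. by rewrite dimvf /dim /= mul1n. Qed.

(** Collects the isomorphism classes over all sharp representatives of the orbit, so neither a
    representative nor a proof of [Z2] has to be chosen. *)
Definition orbit_class (R : realType) (n : nat) (a : symplLie R)
    (o : set (set (triple 'rV[R]_n a))) : symplLie R -> Prop :=
  fun h => exists t (Zt : Z2 t),
    [/\ Z2sharp t, o = Gorbit (cohom_class t) & isomorphic (extension Zt) h].

Lemma orbit_classE (R : realType) (n : nat) (a : symplLie R)
    (t : triple 'rV[R]_n a) (Zt : Z2 t) : Z2sharp t ->
  orbit_class (Gorbit (cohom_class t)) = iso_class (extension Zt).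
Proof.
move=> St; apply/funext => h; apply/propext; split; last by exists t, Zt.
case=> t' [Zt' [St' e iso]]; apply: isomorphic_trans iso.
exact/(isomorphic_extensionP Zt Zt' St St').
Qed.

Lemma H2sharp_mod_GP (R : realType) (l : vectType R) (a : symplLie R)
    (o : set (set (triple l a))) :
  H2sharp_mod_G o -> exists2 t, Z2sharp t & o = Gorbit (cohom_class t).
Proof. by case=> _ [t St <-] <-; exists t. Qed.

Lemma mem_H2sharp_mod_G (R : realType) (l : vectType R) (a : symplLie R)
    (t : triple l a) : Z2sharp t -> H2sharp_mod_G (Gorbit (cohom_class t)).
Proof. by move=> St; exists (cohom_class t) => //; exists t. Qed.

Lemma orbit_class_bij (R : realType) (n : nat) (a : symplLie R) :
  bij_on (H2sharp_mod_G (l := 'rV[R]_n) (a := a))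
    (iso_classes (fun g : symplLie R =>
       \dim (jj g) = n /\ isomorphic (reduction g) a))
    (@orbit_class R n a).
Proof.
split.
- move=> _ /H2sharp_mod_GP[t St ->]; have [Zt _ _] := St.
  rewrite (orbit_classE Zt St); exists (extension Zt) => //; split.
    by rewrite (dim_jj_extension Zt St) dim_rV.
  exact: reduction_extension.
- move=> _ _ /H2sharp_mod_GP[t St ->] /H2sharp_mod_GP[t' St' ->].
  have [Zt _ _] := St; have [Zt' _ _] := St'.
  rewrite (orbit_classE Zt St) (orbit_classE Zt' St') iso_classP.
  by move/(isomorphic_extensionP Zt Zt' St St').
- move=> _ [g [dimj redg] ->].
  have [|t St [Zt iso]] := @isomorphic_extension_of_reduction R 'rV[R]_n a g _ redg.
    by rewrite dimj dim_rV.
  exists (Gorbit (cohom_class t)); first exact: mem_H2sharp_mod_G.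
  by rewrite (orbit_classE Zt St); exact/iso_classP.
Qed.

(** * Assembling the correspondences over all dimensions of [j] *)

Definition coprod_class (R : realType) (x : coprod_type R) : symplLie R -> Prop :=
  orbit_class (projT2 (projT2 x)).

Lemma repr_system_inj (R : realType) (d : nat) (I : symplLie R -> Prop)
    (a b : symplLie R) :
  repr_system d I -> I a -> I b -> isomorphic a b -> a = b.
Proof.
move=> [Idim Irep] Ia Ib ab; have [c [_ uniq]] := Irep a (Idim a Ia).
by rewrite -(uniq a) ?(uniq b) //; split=> //; exact: isomorphic_refl.
Qed.

(** The index of a summand is an isomorphism invariant: [m] is the dimension of [j], and [a] is
    determined up to isomorphism, hence as a representative. Within one summand the classification
    of extensions applies. *)
Lemma coprod_class_bij (R : realType) (Isom : nat -> symplLie R -> Prop) (n : nat) :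
  (forall k : nat, repr_system (2 * k)%N (Isom (2 * k)%N)) ->
  bij_on (coprod_H2 Isom n)
    (iso_classes (fun g : symplLie R =>
       \dim {:g} = (2 * n)%N /\ degenerate_center g)) (@coprod_class R).
Proof.
(* Truncated subtraction still gives [2 n - 2 m = 2 (n - m)], also for [m > n]. *)
move=> HI; have {}HI m : repr_system (2 * n - 2 * m)%N (Isom (2 * n - 2 * m)%N).
  by rewrite -mulnBr.
split.
- move=> _ [m [a [o [-> /andP[m0 mn] Ia /H2sharp_mod_GP[t St ->]]]]].
  have [Zt _ _] := St; rewrite [coprod_class _](orbit_classE Zt St).
  exists (extension Zt) => //; split.
    rewrite dim_extension dim_rV; have [-> // _] := HI m; lia.
  move=> j0; have := dim_jj_extension Zt St.
  by rewrite j0 dimv0 dim_rV => m0'; rewrite -m0' in m0.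
- move=> x y [m [a [o [-> _ Ia /H2sharp_mod_GP[t St ->]]]]].
  move=> [m' [a' [o' [-> _ Ia' /H2sharp_mod_GP[t' St' ->]]]]].
  have [Zt _ _] := St; have [Zt' _ _] := St'.
  rewrite [coprod_class _](orbit_classE Zt St).
  rewrite [coprod_class (coprod_elt (Gorbit (cohom_class t')))](orbit_classE Zt' St').
  rewrite iso_classP => iso.
  have mm' : m = m'.
    have := isomorphic_dim_jj iso.
    by rewrite (dim_jj_extension Zt St) (dim_jj_extension Zt' St') !dim_rV.
  subst m'; have aa' := isomorphic_extension_core St St' iso.
  have e := repr_system_inj (HI m) Ia Ia' aa'.
  subst a'; congr coprod_elt.
  exact/(isomorphic_extensionP Zt Zt' St St').
- move=> _ [g [dimg degg] ->].
  pose m := \dim (jj g).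
  have m0 : (0 < m)%N by rewrite lt0n dimv_eq0; apply/eqP.
  have dimj : \dim (jj g) = \dim {: 'rV[R]_m} by rewrite dim_rV.
  have dimE b (t : triple 'rV[R]_m b) (Zt : Z2 t) : isomorphic (extension Zt) g ->
      (m + \dim {:b} + m)%N = (2 * n)%N.
    by move/isomorphic_dim; rewrite dimg dim_extension dim_rV.
  (* Taking the reduction itself as core presents [g] as an extension of it, which gives its
     dimension and also [m <= n]. *)
  have dimred : (m + \dim {: reduction g} + m)%N = (2 * n)%N.
    have [t _ [Zt]] := isomorphic_extension_of_reduction dimj (isomorphic_refl _).
    exact: dimE.
  have [_ Irep] := HI m.
  have [|a [[Ia redg] _]] := Irep (reduction g); first by lia.
  have [t St [Zt iso]] := isomorphic_extension_of_reduction dimj redg.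
  exists (coprod_elt (Gorbit (cohom_class t))).
    exists m, a, (Gorbit (cohom_class t)); split=> //; first by lia.
    exact: mem_H2sharp_mod_G.
  by rewrite [coprod_class _](orbit_classE Zt St); exact/iso_classP.
Qed.

Theorem theorem7 (R : realType) :
  (forall (n : nat) (a : symplLie R),
    exists f : set (set (triple 'rV[R]_n a)) -> symplLie R -> Prop,
      bij_on (H2sharp_mod_G (l := 'rV[R]_n) (a := a))
        (iso_classes (fun g : symplLie R =>
           \dim (jj g) = n /\ isomorphic (reduction g) a)) f
      /\ forall (t : triple 'rV[R]_n a) (Zt : Z2 t), Z2sharp t ->
           f (Gorbit (cohom_class t)) = iso_class (extension Zt))
  /\
  (forall Isom : nat -> symplLie R -> Prop,
    (forall k : nat, repr_system (2 * k)%N (Isom (2 * k)%N)) ->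
    forall n : nat, (1 <= n)%N ->
    exists F : coprod_type R -> symplLie R -> Prop,
      bij_on (coprod_H2 Isom n)
        (iso_classes (fun g : symplLie R =>
           \dim {:g} = (2 * n)%N /\ degenerate_center g)) F
      /\ forall (m : nat) (a : symplLie R) (t : triple 'rV[R]_m a) (Zt : Z2 t),
           (1 <= m <= n)%N -> Isom (2 * n - 2 * m)%N a -> Z2sharp t ->
           F (coprod_elt (Gorbit (cohom_class t))) = iso_class (extension Zt)).
Proof.
split=> [n a|Isom HI n _].
  exists (@orbit_class R n a); split; first exact: orbit_class_bij.
  by move=> t Zt St; exact: orbit_classE.
exists (@coprod_class R); split; first exact: coprod_class_bij.
by move=> m a t Zt _ _ St; exact: orbit_classE.
Qed.
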